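(* Let $d=1$, let $W$ be an admissible interaction potential with convexity matrix $\kappa$, let $\mu^0\in\mathscr{P}$, and let $\mu$ be the gradient flow solution of the interaction system with initial datum $\mu^0$. Let $i\in\{1,\ldots,n\}$ be fixed, but arbitrary. Assume that the support of $\mu^0_i$ is compact and that $S_i:=\sum_{j=1}^n\kappa_{ij}p_j>0$. Then, for all $t\ge0$, $$\operatorname{diam}\operatorname{supp}\mu_i(t)\le e^{-m_iS_it}\operatorname{diam}\operatorname{supp}\mu^0_i.$$
   Context: Spatial dimension $d=1$. Let $n\in\mathbb{N}$, $m_1,\ldots,m_n>0$, $p_1,\ldots,p_n>0$, $E\in\mathbb{R}$ be fixed. Admissible interaction potential: a map $W:\mathbb{R}\to\mathbb{R}^{n\times n}$ such that $W(z)$ is a symmetric matrix for each $z$; $W_{ij}\in C^1(\mathbb{R};\mathbb{R})$ for all $i,j$; $W(z)=W(-z)$ for all $z$; there is a matrix $\overline W\in\mathbb{R}^{n\times n}$ with $|W_{ij}(z)|\le\overline W_{ij}(1+|z|^2)$ for all $z,i,j$; and there is a symmetric matrix $\kappa\in\mathbb{R}^{n\times n}$ (the convexity matrix, fixed) such that $z\mapsto W_{ij}(z)-\frac12\kappa_{ij}|z|^2$ is convex for all $i,j$. Interaction system: $\partial_t\mu_i=\partial_x\big[m_i\mu_i\,\partial_x\big(\sum_{j=1}^nW_{ij}*\mu_j\big)\big]$, $i=1,\ldots,n$; it holds in the sense of distributions if for all $i$ and all $\varphi\in C_c^\infty((0,\infty)\times\mathbb{R})$: $\int_0^\infty\int_{\mathbb{R}}\big(\partial_t\varphi(t,x)-m_i\partial_x\varphi(t,x)\sum_{j=1}^n\int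 W_{ij}'(x-y)\,\mathrm{d}\mu_j(t,y)\big)\mathrm{d}\mu_i(t,x)\,\mathrm{d}t=0$. $\mathscr{P}$ is the set of $n$-tuples $\mu=(\mu_1,\ldots,\mu_n)$ of nonnegative Borel measures on $\mathbb{R}$ with $\mu_j(\mathbb{R})=p_j$, finite second moments, and $\sum_{j=1}^n\frac1{m_j}\int_{\mathbb{R}}x\,\mathrm{d}\mu_j(x)=E$, with the distance $$\mathbf{W}_{\mathscr{P}}(\mu^0,\mu^1)=\Big[\sum_{j=1}^n\frac1{m_j}\inf\Big\{\int|x-y|^2\,\mathrm{d}\gamma_j(x,y):\gamma_j\in\Gamma(\mu^0_j,\mu^1_j)\Big\}\Big]^{1/2},$$ where $\Gamma(\mu^0_j,\mu^1_j)$ is the set of finite Borel measures on $\mathbb{R}\times\mathbb{R}$ with marginals $\mu_j^0,\mu_j^1$. $AC^2_{\mathrm{loc}}([0,\infty);(X,\mathbf{d}))$ is the set of curves $\mu:[0,\infty)\to X$ such that for each $T>0$ there is $\varphi\in L^2([0,T])$ with $\mathbf{d}(\mu(s),\mu(t))\le\int_s^t\varphi(r)\,\mathrm{d}r$ for $0\le s\le t\le T$. The gradient flow solution with initial datum $\mu^0\in\mathscr{P}$ is the (existing and unique) curve in $AC^2_{\mathrm{loc}}([0,\infty);(\mathscr{P},\mathbf{W}_{\mathscr{P}}))$ with $\mu(0)=\mu^0$ for which the interaction system holds in the sense of distributions. *)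

(* Defs.v *)
From HB Require Import structures.
From mathcomp Require Import all_boot all_order all_algebra.
From mathcomp Require Import all_classical all_reals all_analysis.

Set Implicit Arguments.
Unset Strict Implicit.
Unset Printing Implicit Defensive.

Import Order.TTheory GRing.Theory Num.Theory.
Import numFieldNormedType.Exports.

Local Open Scope classical_set_scope.
Local Open Scope ring_scope.

Notation borel_measure R := {measure set (measurableTypeR R) -> \bar R}.
Notation finite_borel_measure2 R :=
  {finite_measure set (measurableTypeR R * measurableTypeR R)%type -> \bar R}.

Section MeasuresOnTheLine.
Context {R : realType}.

(* Library measures are total functions, meaningful on measurable sets only;
   this is the intended equality of Borel measures. *)
Definition eq_measure (mu nu : borel_measure R) :=
  forall A : set (measurableTypeR R), measurable A -> mu A = nu A.

Definition msupp (mu : borel_measure R) : set R :=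
  [set x | forall U : set R, open U -> U x -> (0 < mu U)%E].

(* +oo for unbounded sets, -oo for the empty set. *)
Definition diam (A : set R) : \bar R :=
  ereal_sup [set (`|z.1 - z.2|)%:E | z in A `*` A].

Definition couplings (mu nu : borel_measure R)
    : set (finite_borel_measure2 R) :=
  [set gamma : finite_borel_measure2 R |
     forall A : set (measurableTypeR R), measurable A ->
     gamma (A `*` setT) = mu A /\ gamma (setT `*` A) = nu A].

Definition W2_squared (mu nu : borel_measure R) : \bar R :=
  ereal_inf [set (\int[gamma]_z ((z.1 - z.2) ^+ 2)%:E)%E
            | gamma in couplings mu nu].

End MeasuresOnTheLine.

Section AbsolutelyContinuousCurves.
Context {R : realType}.

Definition in_L2 (T : R) (phi : R -> R) :=
  measurable_fun `[0, T] phi /\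
  (\int[lebesgue_measure]_(r in `[0%R, T]) ((phi r) ^+ 2)%:E < +oo)%E.

(* Curves on [0, +oo[ are total functions on R whose values at negative times
   are ignored; d is a distance on the subset X of the ambient type S. *)
Definition AC2_loc (S : Type) (X : set S) (d : S -> S -> \bar R)
    (mu : R -> S) :=
  (forall t, 0 <= t -> X (mu t)) /\
  (forall T, 0 < T -> exists phi : R -> R, in_L2 T phi /\
     forall s t, 0 <= s -> s <= t -> t <= T ->
       (d (mu s) (mu t) <= (\int[lebesgue_measure]_(r in `[s, t]) phi r)%:E)%E).

End AbsolutelyContinuousCurves.

Section TestFunctions.
Context {R : realType}.

(* Iterated partial derivative of a function of (t, x): each letter of the word
   is a differentiation, true for d/dt and false for d/dx. *)
Definition direction (b : bool) : R * R := if b then (1, 0) else (0, 1).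

Definition iter_partial (w : seq bool) (f : R * R -> R) : R * R -> R :=
  foldr (fun b g => fun z => 'D_(direction b) g z) f w.

Definition smooth (f : R * R -> R) :=
  forall w, continuous (iter_partial w f) /\
    forall b z, derivable (iter_partial w f) z (direction b).

(* Functions on ]0, +oo[ x R with compact support in that open set, identified
   with their extension by zero to R x R. *)
Definition test_function (f : R * R -> R) :=
  [/\ smooth f,
      compact (closure [set z | f z != 0]) &
      closure [set z | f z != 0] `<=` [set z | 0 < z.1]].

End TestFunctions.

Section InteractionSystem.
Context {R : realType} {n : nat}.
Implicit Types (m p : 'I_n -> R) (W : R -> 'M[R]_n) (kappa : 'M[R]_n).

Definition entry W (i j : 'I_n) : R -> R := fun z => W z i j.

Definition C1 (f : R -> R) :=
  (forall x, derivable f x 1) /\ continuous (derive1 f).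

Definition admissible_potential W kappa :=
  [/\ forall z, (W z)^T = W z,
      forall i j, C1 (entry W i j),
      forall z, W z = W (- z),
      exists Wbar : 'M[R]_n, forall z i j,
        `|W z i j| <= Wbar i j * (1 + `|z| ^+ 2) &
      kappa^T = kappa /\
      forall i j, convex_function setT
        (fun z : R^o => W z i j - 2^-1 * kappa i j * `|z| ^+ 2 : R^o)].

Definition state_space m p (E : R) : set ('I_n -> borel_measure R) :=
  [set mu : 'I_n -> borel_measure R | [/\ forall j, mu j setT = (p j)%:E,
      forall j, (\int[mu j]_x (x ^+ 2)%:E < +oo)%E &
      \sum_j (m j)^-1 * (\int[mu j]_x x) = E]].

Definition W_P m (mu nu : 'I_n -> borel_measure R) : \bar R :=
  sqrte (\sum_j ((m j)^-1)%:E * W2_squared (mu j) (nu j))%E.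

Definition interaction_force W (mu : 'I_n -> borel_measure R) (i : 'I_n)
    (x : R) : R :=
  \sum_j \int[mu j]_y (derive1 (entry W i j) (x - y)).

Definition distributional_solution m W (mu : R -> 'I_n -> borel_measure R) :=
  forall i (f : R * R -> R), test_function f ->
    (\int[lebesgue_measure]_(t in `]0%R, +oo[) \int[mu t i]_x
       ('D_(direction true) f (t, x)
        - m i * 'D_(direction false) f (t, x)
          * interaction_force W (mu t) i x)%:E = 0)%E.

Definition gradient_flow_solution m p E W (mu0 : 'I_n -> borel_measure R)
    (mu : R -> 'I_n -> borel_measure R) :=
  [/\ AC2_loc (state_space m p E) (W_P m) mu,
      forall j, eq_measure (mu 0 j) (mu0 j) &
      distributional_solution m W mu].

End InteractionSystem.

(* Main.v *)
Require Import Defs.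
From mathcomp Require Import all_boot all_order all_algebra.
From mathcomp Require Import all_classical all_reals all_analysis.
From mathcomp Require Import measurable_realfun.
From mathcomp Require Import ring lra.

Set Implicit Arguments.
Unset Strict Implicit.
Unset Printing Implicit Defensive.

Import Order.TTheory GRing.Theory Num.Theory.
Import numFieldNormedType.Exports.

Local Open Scope classical_set_scope.
Local Open Scope ring_scope.

(** The species [i] is transported by the velocity
    [v t x = - m_i * sum_j int W_ij'(x - y) dmu_j(t, y)], which by convexity
    satisfies [v t x - v t y <= - lam * (x - y)] for [y <= x], where
    [lam = m_i S_i]; in particular [v t] is decreasing.  It is also continuous
    in [(t, x)], because the curve is continuous for the transport distance
    and [W_ij'] has linear growth.

    If [beta] and [rho] are affine in time with [beta' >= v t beta] and
    [rho' <= v t rho], and [beta < x < rho] carries no mass initially, it never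
    does: for the flat function [h x = exp(-1/x)], testing the equation with
    [h (x - beta) * h (rho - x)], times a cutoff in time, produces a
    nonpositive term because [v t] is decreasing, so the mass seen by
    [h (x - beta) * h (rho - x)] cannot grow.  No flow of [v] is needed.

    Barriers leaving the two ends of the support at time [t] with slopes
    [v t b + e] and [v t a - e] (and an auxiliary barrier sent to infinity)
    bound the support on a short time interval, and [1 - lam * s <=
    exp(- lam * s)] turns this into the decay of the diameter, up to [2 e] per
    unit of time.  Lower semicontinuity of the support allows passing to left
    limits, so real induction gives the estimate for all times; then let [e]
    tend to [0]. *)

(** * Smooth test functions *)

Section FlatFunctions.
Context {R : realType}.
Implicit Types (p : {poly R}) (x : R).

(** Keeping a polynomial in [x^-1] as a parameter makes the family closed under differentiation;
    [flat 1] is the classical smooth function [exp(-1/x)] extended by zero. *)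
Definition flat p x : R := if 0 < x then p.[x^-1] * expR (- x^-1) else 0.

(** The exponential series gives [y^i * exp(-y) <= i!] for each monomial, so the constant is the sum
    of the coefficients in absolute value weighted by factorials. *)
Lemma horner_expRN_bounded p :
  exists C : R, forall y, 0 < y -> `|p.[y] * expR (- y)| <= C.
Proof.
elim/poly_ind: p => [|p c _].
  by exists 0 => y y0; rewrite horner0 mul0r normr0.
set q := p * 'X + c%:P.
exists (\sum_(i < size q) `|q`_i| * (i`!)%:R) => y y0.
rewrite horner_coef mulr_suml (le_trans (ler_norm_sum _ _ _))//.
apply: ler_sum => i _.
rewrite -mulrA normrM ler_wpM2l// ger0_norm; last first.
  by rewrite mulr_ge0 ?expR_ge0// exprn_ge0// ltW.
rewrite expRN ler_pdivrMr ?expR_gt0//.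
case: (nat_of_ord i) => [|k].
  by rewrite expr0 fact0 mul1r -expR0 ler_expR ltW.
have := @expR_ge1Dxn R y k (ltW y0).
rewrite -ler_pdivrMl ?ltr0n ?fact_gt0// mulrC => h.
by apply: le_trans h; rewrite lerDr.
Qed.

Lemma flat_bounded p : exists C : R, forall x, `|flat p x| <= C.
Proof.
have [C HC] := horner_expRN_bounded p; exists (Num.max C 0) => x.
rewrite /flat; case: ifPn => x0; last by rewrite normr0 le_max lexx orbT.
by rewrite le_max HC ?invr_gt0.
Qed.

(** A power of [x] can be pulled out at the price of a factor ['X]; this shows the flatness at the
    origin. *)
Lemma flatMX p x : flat p x = x * flat (p * 'X) x.
Proof.
rewrite /flat; case: ifPn => x0; last by rewrite mulr0.
by rewrite hornerM hornerX; field; rewrite gt_eqF.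
Qed.

(** By the chain rule, [p(1/x) exp(-1/x)] has derivative [(p - p')(1/x) x^-2 exp(-1/x)]. *)
Definition flat_deriv p := (p - p^`()) * 'X^2.

Lemma is_derive_flat p x : is_derive x 1 (flat p) (flat (flat_deriv p) x).
Proof.
have [x0|x0|->] := ltgtP x 0.
- rewrite [flat (flat_deriv p) x]/flat ltNge ltW//=.
  apply: (@near_eq_is_derive _ _ _ (cst 0)).
    by near=> y; rewrite /flat ltNge ltW//=; near: y; exact: lt_nbhsl.
- rewrite [flat (flat_deriv p) x]/flat x0.
  have xN0 : x != 0 by rewrite gt_eqF.
  have dV : is_derive x 1 (fun y : R => y^-1) (- x ^- 2).
    apply: DeriveDef; first exact: derivableV.
    by rewrite deriveV// derive_id scaler1.
  apply: (@near_eq_is_derive _ _ _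
    (fun y : R => (horner p \o (fun y : R => y^-1)) y *
                  (expR \o (fun y : R => - y^-1)) y)).
    by near=> y; rewrite /flat ifT//; near: y; exact: lt_nbhsr.
  apply: is_derive_eq.
  rewrite /flat_deriv !hornerE /= /GRing.scale /=.
  by field.
- rewrite [flat (flat_deriv p) 0]/flat ltxx.
  (* Pulling out two powers of [h], the difference quotient at 0 is [h] times a bounded function. *)
  have [C HC] := flat_bounded (p * 'X * 'X).
  have C0 : 0 <= C by exact: le_trans (normr_ge0 _) (HC 0).
  have lim0 : h^-1 *: (flat p (h *: 1 + 0) - flat p 0) @[h --> (0:R)^'] --> (0 : R).
    apply/cvgrPdist_le => /= e e0; near=> h.
    have hN0 : h != 0 by near: h; exact: nbhs_dnbhs_neq.
    rewrite sub0r normrN [flat p 0]/flat ltxx subr0 addr0 scaler1.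
    have -> : h^-1 *: flat p h = h * flat (p * 'X * 'X) h.
      by rewrite (flatMX p) (flatMX (p * _)); exact: mulKf.
    rewrite normrM (@le_trans _ _ (`|h| * (C + 1)))//.
      by rewrite ler_wpM2l// (le_trans (HC h))// lerDl.
    rewrite -ler_pdivlMr ?ltr_pwDr//.
    by near: h; apply: dnbhs0_le; rewrite divr_gt0// ltr_pwDr.
  apply: DeriveDef; last exact: cvg_lim lim0.
  by apply: (cvgP 0).
Unshelve. all: by end_near.
Qed.

End FlatFunctions.

Section SmoothExpressions.
Context {R : realType}.

(** Test functions are represented by syntax: the partial derivatives of an expression are again
    expressions, computed by [sderive], so iterated partials of every order are handled at once. *)
Inductive sexpr :=
| SCst of R
| STime
| SSpace
| SAdd of sexpr & sexpr
| SMul of sexpr & sexpr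
| SFlat of {poly R} & sexpr.

Fixpoint seval (e : sexpr) (z : R * R) : R :=
  match e with
  | SCst c => c
  | STime => z.1
  | SSpace => z.2
  | SAdd e1 e2 => seval e1 z + seval e2 z
  | SMul e1 e2 => seval e1 z * seval e2 z
  | SFlat p e1 => flat p (seval e1 z)
  end.

Fixpoint sderive (b : bool) (e : sexpr) : sexpr :=
  match e with
  | SCst _ => SCst 0
  | STime => SCst b%:R
  | SSpace => SCst (~~ b)%:R
  | SAdd e1 e2 => SAdd (sderive b e1) (sderive b e2)
  | SMul e1 e2 => SAdd (SMul e1 (sderive b e2)) (SMul e2 (sderive b e1))
  | SFlat p e1 => SMul (SFlat (flat_deriv p) e1) (sderive b e1)
  end.

Lemma differentiable_flat (p : {poly R}) x : differentiable (flat p) x.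
Proof. by apply/derivable1_diffP; have [] := is_derive_flat p x. Qed.

Lemma differentiable_seval e z : differentiable (seval e) z.
Proof.
elim: e => [c|||e1 IH1 e2 IH2|e1 IH1 e2 IH2|p e IH] /=.
- exact: differentiable_cst.
- by apply: (@linear_differentiable _ _ _ (@fst R R : {linear _ -> _})) => u; exact: cvg_fst.
- by apply: (@linear_differentiable _ _ _ (@snd R R : {linear _ -> _})) => u; exact: cvg_snd.
- exact: differentiableD.
- exact: differentiableM.
- exact: differentiable_comp IH (differentiable_flat _ _).
Qed.

Lemma derive_seval b e z :
  'D_(direction b) (seval e) z = seval (sderive b e) z.
Proof.
have dv e' : derivable (seval e') z (direction b).
  exact: diff_derivable (differentiable_seval _ _).
elim: e => [c|||e1 IH1 e2 IH2|e1 IH1 e2 IH2|p e IH] /=.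
- exact: derive_cst.
- rewrite deriveE; last exact: (differentiable_seval STime).
  by rewrite (@diff_lin _ _ _ (@fst R R : {linear _ -> _})); [case: b dv|move=> u; exact: cvg_fst].
- rewrite deriveE; last exact: (differentiable_seval SSpace).
  by rewrite (@diff_lin _ _ _ (@snd R R : {linear _ -> _})); [case: b dv|move=> u; exact: cvg_snd].
- by rewrite (deriveD (dv e1) (dv e2)) IH1 IH2.
- by rewrite (deriveM (dv e1) (dv e2)) IH1 IH2.
- rewrite deriveE; last exact: (differentiable_seval (SFlat p e)).
  rewrite -[LHS]/('d (flat p \o seval e) z (direction b)).
  rewrite diff_comp; [|exact: differentiable_seval|exact: differentiable_flat].
  rewrite /= -(deriveE _ (differentiable_seval e z)).
  have [dp ep] := is_derive_flat p (seval e z).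
  by rewrite IH deriv1E// derive1E ep; exact: mulrC.
Qed.

Lemma iter_partial_seval w e : exists e', iter_partial w (seval e) = seval e'.
Proof.
elim: w => [|b w [e' IH]]; first by exists e.
exists (sderive b e'); apply/funext => z /=.
by rewrite -/(iter_partial w (seval e)) IH derive_seval.
Qed.

Lemma smooth_seval e : smooth (seval e).
Proof.
move=> w; have [e' ->] := iter_partial_seval w e; split => [z|b z].
  exact: differentiable_continuous (differentiable_seval _ _).
exact: diff_derivable (differentiable_seval _ _).
Qed.

(** The rectangle is closed, so it also contains the closure of the nonvanishing set; [0 < a] keeps
    it away from time 0. *)
Lemma test_function_seval e (a b c d : R) : 0 < a ->
  (forall z, seval e z != 0 -> [/\ a <= z.1, z.1 <= b, c <= z.2 & z.2 <= d]) ->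
  test_function (seval e).
Proof.
move=> a0 H.
have cB : closed (`[a, b] `*` `[c, d] : set (R * R)).
  apply: compact_closed; first exact: norm_hausdorff.
  by apply: compact_setX; exact: segment_compact.
have sub : closure [set z | seval e z != 0] `<=` `[a, b] `*` `[c, d].
  rewrite [X in _ `<=` X](closure_id _).1//; apply: closureS => z /= /H.
  by rewrite !in_itv/= => -[-> -> -> ->].
split; first exact: smooth_seval.
- apply: (subclosed_compact _ _ sub); first exact: closed_closure.
  by apply: compact_setX; exact: segment_compact.
- move=> z /sub[/= + _]; rewrite in_itv/= => /andP[az _].
  exact: lt_le_trans az.
Qed.

End SmoothExpressions.

(** * Transport distance *)

Section MonotonicityWithoutMeasurability.
Context d (T : measurableType d) (R : realType).
Variable mu : {measure set T -> \bar R}.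

(* The integral of a nonnegative function is a supremum over simple functions
   below it, hence monotone even among non-measurable functions. *)
Lemma le_integral_pointwise (D : set T) (f g : T -> \bar R) :
  (forall x, D x -> (f x <= g x)%E) ->
  (\int[mu]_(x in D) f x <= \int[mu]_(x in D) g x)%E.
Proof.
move=> fg.
have fg' x : ((f \_ D) x <= (g \_ D) x)%E.
  by rewrite /patch; case: ifPn => // /set_mem /fg.
rewrite /integral; apply: leeB; apply: ereal_sup_le => _ [h hf <-];
  exists h => // x; apply: le_trans (hf x) _.
- by rewrite !funeposE ge_max !le_max fg' lexx orbT.
- by rewrite !funenegE ge_max !le_max leeN2 fg' lexx orbT.
Qed.

End MonotonicityWithoutMeasurability.

Section ImageMeasure.
Context d1 d2 (X : measurableType d1) (Y : measurableType d2) (R : realType).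

(** Change of variables for a measure known to be an image measure only on measurable sets; applied
    to the two projections of a coupling. *)
Lemma Rintegral_image (gamma : {measure set X -> \bar R})
    (mu : {measure set Y -> \bar R}) (phi : X -> Y) (f : Y -> R) :
  measurable_fun setT phi ->
  (forall A, measurable A -> gamma (phi @^-1` A) = mu A) ->
  mu.-integrable setT (EFin \o f) ->
  gamma.-integrable setT (EFin \o (f \o phi)) /\
  \int[mu]_x f x = \int[gamma]_z f (phi z).
Proof.
move=> mphi Hphi fi.
have mf : measurable_fun setT f by exact/measurable_EFinP/(measurable_int _ fi).
have gi : gamma.-integrable setT (EFin \o (f \o phi)).
  apply/integrableP; split.
    by apply/measurable_EFinP; exact: measurableT_comp mphi.
  have /integrableP[_] := fi.
  rewrite (eq_measure_integral (pushforward gamma phi)) /=; last first.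
    by move=> A mA _; rewrite /pushforward Hphi.
  rewrite ge0_integral_pushforward//.
  by apply: measurableT_comp => //; exact: measurableT_comp.
split => //.
rewrite /Rintegral (eq_measure_integral (pushforward gamma phi)) /=; last first.
  by move=> A mA _; rewrite /pushforward Hphi.
by rewrite integral_pushforward//; exact/measurable_EFinP.
Qed.

End ImageMeasure.

Section TransportBound.
Context {R : realType}.
Implicit Types (mu nu : borel_measure R) (e : R).
Local Notation fint mu f :=
  (mu.-integrable setT (EFin \o (f : measurableTypeR R -> R))).

(* One half of Kantorovich duality: all that is used of a coupling of cost at
   most e. *)
Definition transport_close e mu nu := forall (f g : R -> R) (K : R),
  fint mu f -> fint nu g -> 0 <= K ->
  (forall x y, f x <= g y + K * (x - y) ^+ 2) ->
  \int[mu]_x f x <= \int[nu]_x g x + K * e.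

(** Integrate [f x <= g y + K (x - y)^2] against the coupling. The auxiliary [key] abstracts the two
    projections so that it serves both orders of the marginals. *)
Lemma coupling_transport_close e mu nu (gamma : finite_borel_measure2 R) :
  couplings mu nu gamma ->
  (\int[gamma]_z ((z.1 - z.2) ^+ 2)%:E <= e%:E)%E ->
  transport_close e mu nu /\ transport_close e nu mu.
Proof.
have sq_int : (\int[gamma]_z ((z.1 - z.2) ^+ 2)%:E <= e%:E)%E ->
    gamma.-integrable setT (EFin \o (fun z => (z.1 - z.2) ^+ 2)) /\
    \int[gamma]_z ((z.1 - z.2) ^+ 2) <= e.
  move=> ge.
  have gi : gamma.-integrable setT (EFin \o (fun z => (z.1 - z.2) ^+ 2)).
    apply/integrableP; split.
      apply/measurable_EFinP; apply: measurable_funX.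
      exact: measurable_funB.
    under eq_integral do rewrite /= ger0_norm ?sqr_ge0//.
    exact: le_lt_trans ge (ltry _).
  by split => //; rewrite /Rintegral -lee_fin fineK// integrable_fin_num.
have key (mu' nu' : borel_measure R)
    (phi psi : measurableTypeR R * measurableTypeR R -> measurableTypeR R) :
  measurable_fun setT phi -> measurable_fun setT psi ->
  (forall A : set (measurableTypeR R), measurable A ->
     gamma (phi @^-1` A) = mu' A) ->
  (forall A : set (measurableTypeR R), measurable A ->
     gamma (psi @^-1` A) = nu' A) ->
  (forall z, (phi z - psi z : R) ^+ 2 = (z.1 - z.2) ^+ 2) ->
  (\int[gamma]_z ((z.1 - z.2) ^+ 2)%:E <= e%:E)%E ->
  transport_close e mu' nu'.
  move=> mphi mpsi Hphi Hpsi Hpp /sq_int[gi ge] f g K fi gi' K0 fg.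
  have [fi1 ->] := Rintegral_image mphi Hphi fi.
  have [gi1 ->] := Rintegral_image mpsi Hpsi gi'.
  have Ki : gamma.-integrable setT (EFin \o (fun z => K * (z.1 - z.2) ^+ 2)).
    exact: (integrableZl _ K gi).
  apply: (@le_trans _ _ (\int[gamma]_z (g (psi z) + K * (z.1 - z.2) ^+ 2))).
    apply: le_Rintegral => //; first exact: (integrableD _ gi1 Ki).
    by move=> z _; rewrite (le_trans (fg _ (psi z)))// Hpp.
  by rewrite RintegralD// RintegralZl// lerD2l ler_wpM2l.
move=> cg ge.
have H1 (A : set (measurableTypeR R)) : measurable A -> gamma (fst @^-1` A) = mu A.
  move=> mA; rewrite -(cg A mA).1; congr (gamma _).
  by apply/seteqP; split => z //= [].
have H2 (A : set (measurableTypeR R)) : measurable A -> gamma (snd @^-1` A) = nu A.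
  move=> mA; rewrite -(cg A mA).2; congr (gamma _).
  by apply/seteqP; split => z //= [].
split.
- exact: (key _ _ _ _ measurable_fst measurable_snd H1 H2).
- by apply: (key _ _ _ _ measurable_snd measurable_fst H2 H1) => // z; ring.
Qed.

End TransportBound.

Section Curves.
Context {R : realType}.

(** One summand of the squared distance is at most the whole, so the squared transport distance of
    species [j] is at most [m j * B^2]. The strict inequality with [e] then yields an actual
    coupling of cost below [e], without an optimal one. *)
Lemma W_P_transport_close n (m : 'I_n -> R) (mu nu : 'I_n -> borel_measure R)
    (B e : R) :
  (forall j, 0 < m j) -> 0 <= B -> (W_P m mu nu <= B%:E)%E ->
  forall j, m j * B ^+ 2 < e ->
  transport_close e (mu j) (nu j) /\ transport_close e (nu j) (mu j).
Proof.
move=> m0 B0 WB j Be.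
have W20 k : (0 <= W2_squared (mu k) (nu k))%E.
  by apply: le_ereal_inf_tmp => _ [gamma _ <-]; apply: integral_ge0 => z _; rewrite lee_fin sqr_ge0.
have t0 k : (0 <= ((m k)^-1)%:E * W2_squared (mu k) (nu k))%E.
  by rewrite mule_ge0// lee_fin invr_ge0 ltW.
have : (((m j)^-1)%:E * W2_squared (mu j) (nu j) <= (B ^+ 2)%:E)%E.
  apply: (@le_trans _ _ (\sum_k ((m k)^-1)%:E * W2_squared (mu k) (nu k))%E).
    by rewrite (bigD1 j)//= leeDl// sume_ge0.
  have B20 : (0 <= (B ^+ 2)%:E)%E by rewrite lee_fin sqr_ge0.
  by rewrite -(lee_sqrt _ B20)// [leRHS]/= sqrtr_sqr ger0_norm.
rewrite lee_pdivrMl// -EFinM => WmB.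
have : (W2_squared (mu j) (nu j) < e%:E)%E.
  by apply: le_lt_trans WmB _; rewrite lte_fin.
move=> /ereal_inf_lt[_ [gamma cg <-]] /ltW.
exact: coupling_transport_close.
Qed.

(** Substitute for the Cauchy-Schwarz inequality: integrate the pointwise bound
    [phi <= 1/eta + eta * phi^2]. *)
Lemma Rintegral_AMGM (phi : R -> R) (T eta s t : R) :
  in_L2 T phi -> 0 < eta -> 0 <= s -> s <= t -> t <= T ->
  \int[lebesgue_measure]_(r in `[s, t]) phi r <=
  (t - s) / eta + eta * fine (\int[lebesgue_measure]_(r in `[0%R, T]) ((phi r) ^+ 2)%:E)%E.
Proof.
move=> [mphi phi2] eta0 s0 st tT.
set M := (\int[lebesgue_measure]_(r in `[0%R, T]) ((phi r) ^+ 2)%:E)%E in phi2 *.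
have M0 : (0 <= M)%E by apply: integral_ge0 => r _; rewrite lee_fin sqr_ge0.
have Mfin : M \is a fin_num by rewrite ge0_fin_numE.
have rhs0 : 0 <= (t - s) / eta + eta * fine M.
  by rewrite addr_ge0// mulr_ge0 ?fine_ge0 ?subr_ge0 ?invr_ge0// ltW.
have sub : `[s, t] `<=` `[0, T].
  move=> r /=; rewrite !in_itv/= => /andP[sr rt].
  by rewrite (le_trans s0 sr) (le_trans rt tT).
have mphi2 (D : set R) : measurable D -> D `<=` `[0, T] ->
    measurable_fun D (fun r => ((phi r) ^+ 2)%:E).
  move=> mD DT; apply/measurable_EFinP; apply: measurable_funX.
  exact: measurable_funS mphi.
rewrite /Rintegral; set I := (X in fine X).
have : (I <= ((t - s) / eta + eta * fine M)%:E)%E.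
  apply: (@le_trans _ _ (\int[lebesgue_measure]_(r in `[s, t])
      (cst (eta^-1)%:E r + eta%:E * (phi r ^+ 2)%:E)))%E.
    apply: le_integral_pointwise => r _; rewrite /cst /= -EFinM -EFinD lee_fin.
    have [p0|p0] := leP (phi r) 0.
      apply: (le_trans p0); apply: addr_ge0; first by rewrite invr_ge0 ltW.
      by apply: mulr_ge0; [exact: ltW|exact: sqr_ge0].
    rewrite -subr_ge0 (_ : _ - _ = eta^-1 * ((eta * phi r - 2^-1) ^+ 2 + 3/4)).
      by rewrite mulr_ge0 ?invr_ge0 ?ltW// ltr_wpDl// sqr_ge0.
    by field; rewrite gt_eqF.
  rewrite ge0_integralD//=; last 3 first.
  - by move=> r _; rewrite lee_fin invr_ge0 ltW.
  - by move=> r _; rewrite -EFinM lee_fin mulr_ge0 ?sqr_ge0// ltW.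
  - by apply: measurable_funeM; exact: mphi2.
  rewrite integral_cst// ge0_integralZl_EFin//; last 3 first.
  - by move=> r _; rewrite lee_fin sqr_ge0.
  - exact: mphi2.
  - exact: ltW.
  rewrite EFinD leeD//.
    rewrite [X in (_ * X)%E](lebesgue_measure_itv `[s, t])/= lte_fin; case: ltP => ts.
      by rewrite -EFinB -EFinM lee_fin mulrC.
    by rewrite mule0 lee_fin mulr_ge0 ?subr_ge0// invr_ge0 ltW.
  rewrite EFinM fineK//; apply: lee_wpmul2l; first by rewrite lee_fin ltW.
  rewrite /M; apply: ge0_subset_integral => //.
    exact: mphi2.
  by move=> r _; rewrite lee_fin sqr_ge0.
(* If the integral is [-oo], its [fine] is 0, and the nonnegativity [rhs0] is what closes the
   case. *)
by move: I => [r|//|_] //=; rewrite lee_fin.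
Qed.

(** Uniform continuity in time of every species on [[0, T]], in the dual form that later arguments
    consume. *)
Lemma AC2_transport_close n (m : 'I_n -> R) X
    (mu : R -> 'I_n -> borel_measure R) (T e : R) :
  (forall j, 0 < m j) -> AC2_loc X (W_P m) mu -> 0 < T -> 0 < e ->
  exists2 d : R, 0 < d & forall s t j, 0 <= s -> s <= T -> 0 <= t -> t <= T ->
    `|s - t| <= d -> transport_close e (mu s j) (mu t j).
Proof.
move=> m0 [_ /(_ T)AC] T0 e0; have [phi [L2phi Hphi]] := AC T0.
set M := fine (\int[lebesgue_measure]_(r in `[0%R, T]) ((phi r) ^+ 2)%:E)%E.
have M0 : 0 <= M by apply: fine_ge0; apply: integral_ge0 => r _; rewrite lee_fin sqr_ge0.
pose Sm := \sum_j m j.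
have Sm0 : 0 <= Sm by apply: sumr_ge0 => j _; exact: ltW.
have mSm j : m j <= Sm by rewrite /Sm (bigD1 j)//= lerDl sumr_ge0// => k _; exact: ltW.
(* A distance [k] for which [m j * k^2 < e] holds for all species at once. Below, [eta] makes the
   term [eta * M] at most [k / 2], and the time step [eta * (k / 2)] does the same for
   [(t - s) / eta]. *)
pose k := Num.sqrt (e / (Sm + 1)).
have k0 : 0 < k by rewrite sqrtr_gt0 divr_gt0// ltr_wpDl.
have mk j : m j * k ^+ 2 < e.
  rewrite sqr_sqrtr ?ltW ?divr_gt0 ?ltr_wpDl//.
  rewrite mulrA ltr_pdivrMr ?ltr_wpDl// mulrC ltr_pM2l//.
  by rewrite (le_lt_trans (mSm j))// ltrDl.
pose eta := k / 2 / (M + 1).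
have eta0 : 0 < eta by rewrite !divr_gt0// ltr_wpDl.
exists (eta * (k / 2)); first by rewrite mulr_gt0// divr_gt0.
have main s t j : 0 <= s -> s <= t -> t <= T -> t - s <= eta * (k / 2) ->
  transport_close e (mu s j) (mu t j) /\ transport_close e (mu t j) (mu s j).
  move=> s0 st tT ts.
  apply: (@W_P_transport_close _ m _ _ k) => //; first exact: ltW.
  apply: le_trans (Hphi _ _ s0 st tT) _; rewrite lee_fin.
  apply: le_trans (Rintegral_AMGM L2phi eta0 s0 st tT) _; rewrite -/M.
  rewrite [leRHS](splitr k) lerD//; first by rewrite ler_pdivrMr// mulrC.
  rewrite /eta mulrAC ler_pdivrMr ?ltr_wpDl//.
  by apply: ler_wpM2l; [rewrite divr_ge0// ltW|rewrite lerDl].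
move=> s t j s0 sT t0 tT std.
have [st|/ltW ts] := leP s t.
- have [] := main s t j s0 st tT _ => //.
  by move: std; rewrite ler0_norm ?subr_le0// opprB.
- have [] := main t s j t0 ts sT _ => //.
  by move: std; rewrite ger0_norm ?subr_ge0.
Qed.

End Curves.

(** * Interaction force *)

Section Convexity.
Context {R : realType}.

(** For [h] in []0, 1]] convexity bounds the difference quotient along [y - x] by [g y - g x]; let
    [h] tend to 0 from the right. *)
Lemma convex_tangent (g : R -> R) (x y : R) :
  convex_function setT (g : R^o -> R^o) -> derivable g x 1 ->
  g x + derive1 g x * (y - x) <= g y.
Proof.
move=> cvx dg; rewrite -lerBrDl.
have df : differentiable g x by apply/derivable1_diffP.
set c := y - x.
have lim0 : h^-1 *: (g (h *: c + x) - g x) @[h --> (0:R)^'] --> derive1 g x * c.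
  have -> : derive1 g x * c = 'D_c g x by rewrite deriveE// deriv1E// mulrC.
  exact: diff_derivable df.
have {}lim0 : h^-1 *: (g (h *: c + x) - g x) @[h --> (0:R)^'+] --> derive1 g x * c.
  exact: cvg_dnbhs_at_right.
have h01 : \forall h \near (0:R)^'+, h^-1 *: (g (h *: c + x) - g x) <= g y - g x.
  near=> h.
  have h0 : 0 < h by [].
  have h1 : h <= 1 by near: h; exact: nbhs_right_le.
  pose t := Itv01 (ltW h0) h1.
  have := cvx t y x; rewrite !inE => /(_ Logic.I Logic.I).
  rewrite !convRE /= => H.
  have -> : h *: c + x = h * y + (1 - h) * x.
    by rewrite -[h *: c]/(h * c) /c; ring.
  rewrite -[_ *: _]/(h^-1 * _) mulrC ler_pdivrMr//.
  apply: le_trans (lerB H (lexx _)) _.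
  by rewrite [X in _ + X * _](_ : _ = 1 - h)// le_eqVlt; apply/orP; left; apply/eqP; ring.
by apply: (cvgr_to_le lim0).
Unshelve. all: by end_near.
Qed.

Section SemiconvexPotential.
Variables (w : R -> R) (k C : R).
Hypothesis C1w : C1 w.
Hypothesis w_growth : forall z, `|w z| <= C * (1 + `|z| ^+ 2).
Hypothesis w_convex :
  convex_function setT (fun z : R^o => w z - 2^-1 * k * `|z| ^+ 2 : R^o).

(** Tangent inequality of the convex function [w z - k z^2 / 2], with the quadratic terms
    regrouped. *)
Lemma semiconvex_tangent x y :
  w x + derive1 w x * (y - x) + 2^-1 * k * (y - x) ^+ 2 <= w y.
Proof.
have [dw _] := C1w.
pose q := (fun z : R => w z - (2^-1 * k) *: (z ^+ 2)).
have qE : q = (fun z : R^o => w z - 2^-1 * k * `|z| ^+ 2 : R^o).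
  by apply/funext => z; rewrite /q real_normK// num_real.
have dq : is_derive x 1 q (derive1 w x - (2^-1 * k) *: (x *+ 2)).
  have dwx : is_derive x 1 w (derive1 w x).
    by rewrite derive1E; apply: derivableP.
  have d2 : is_derive x 1 (fun z : R => z ^+ 2) (x *+ 2).
    by apply: is_derive_eq; rewrite -[x%:A]/(x * 1) mulr1 mulr2n.
  exact: is_deriveB.
have := @convex_tangent q x y; rewrite {1}qE => /(_ w_convex).
have [dq1 dq2] := dq; move=> /(_ dq1); rewrite derive1E dq2 /q.
rewrite -![_ *: _]/(_ * _) => H.
suff -> : w x + derive1 w x * (y - x) + 2^-1 * k * (y - x) ^+ 2 =
  w x - 2^-1 * k * x ^+ 2 + (derive1 w x - 2^-1 * k * (x *+ 2)) * (y - x) +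
  2^-1 * k * y ^+ 2 by rewrite -lerBrDr.
by field.
Qed.

(** Add the tangent inequalities based at [x] and at [y]. *)
Lemma semiconvex_derive1_mono x y :
  k * (x - y) ^+ 2 <= (derive1 w x - derive1 w y) * (x - y).
Proof.
have := semiconvex_tangent x y; have := semiconvex_tangent y x.
set a := derive1 w x; set b := derive1 w y => h1 h2.
have := lerD h1 h2.
rewrite -subr_ge0 => h; rewrite -subr_ge0.
by apply: le_trans h _; rewrite le_eqVlt; apply/orP; left; apply/eqP; field.
Qed.

(** Use the tangent inequality at the two points at distance [1 + |x|] from [x]: there the growth of
    [w] bounds the slope times [1 + |x|] by a multiple of [(1 + |x|)^2]. *)
Lemma semiconvex_derive1_growth :
  exists K, forall x, `|derive1 w x| <= K * (1 + `|x|).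
Proof.
have C0 : 0 <= C.
  by have := w_growth 0; rewrite normr0 expr0n/= addr0 mulr1; apply: le_trans.
exists (8 * C + `|k|) => x.
have d0 : 0 < 1 + `|x| by rewrite ltr_pwDl.
have x2 : x ^+ 2 = `|x| ^+ 2 by rewrite real_normK// num_real.
have key y : `|y - x| = 1 + `|x| ->
    derive1 w x * (y - x) <= (8 * C + `|k|) * (1 + `|x|) ^+ 2.
  move=> yx.
  have yx2 : (y - x) ^+ 2 = (1 + `|x|) ^+ 2.
    by rewrite -yx real_normK// num_real.
  have ny : `|y| <= 1 + 2 * `|x|.
    have -> : y = (y - x) + x by rewrite subrK.
    by rewrite (le_trans (ler_normD _ _))// yx; lra.
  have := semiconvex_tangent x y; rewrite yx2.
  have := w_growth x; have := w_growth y.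
  rewrite !ler_norml => /andP[_ wy] /andP[wx _].
  have y2 : `|y| ^+ 2 <= (1 + 2 * `|x|) ^+ 2.
    by rewrite ler_sqr ?nnegrE// addr_ge0// mulr_ge0.
  have wy' : w y <= C * (1 + (1 + 2 * `|x|) ^+ 2).
    by apply: le_trans wy _; rewrite ler_wpM2l// lerD2l.
  have kk : - (2^-1 * k) <= `|k|.
    have : - k <= `|k| by rewrite -normrN ler_norm.
    by have := normr_ge0 k; lra.
  have kk2 : - (2^-1 * k) * (1 + `|x|) ^+ 2 <= `|k| * (1 + `|x|) ^+ 2.
    by rewrite ler_wpM2r// sqr_ge0.
  move: wx wy' kk2; have := normr_ge0 x; set a := `|x| => a0 wx wy' kk2 T.
  have Ca : 0 <= C * a by rewrite mulr_ge0.
  have Ca2 : 0 <= C * a ^+ 2 by rewrite mulr_ge0// sqr_ge0.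
  lra.
have a1 : `|x + (1 + `|x|) - x| = 1 + `|x|.
  by rewrite addrC addKr ger0_norm// ltW.
have a2 : `|x - (1 + `|x|) - x| = 1 + `|x|.
  by rewrite addrC addKr normrN ger0_norm// ltW.
have := key _ a1; have := key _ a2.
rewrite [x - _ - x]addrC addKr [x + _ - x]addrC addKr mulrN expr2 mulrA.
rewrite -mulNr !ler_pM2r// => h1 h2.
by rewrite ler_norml lerNl h1.
Qed.

End SemiconvexPotential.
End Convexity.

(** * Moduli of continuity adapted to the quadratic cost *)

Section Moduli.
Context {R : realType}.

(** A Heine theorem in which only [x] is confined to the segment while [y] may leave it; compactness
    enters through near-coverings. *)
Lemma continuous_segment_modulus (f : R -> R) (a b e : R) :
  continuous f -> 0 < e ->
  exists2 d : R, 0 < d & forall x y, a <= x -> x <= b -> `|x - y| <= d ->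
    `|f x - f y| <= e.
Proof.
move=> cf e0.
have /compact_near_coveringP covering := @segment_compact R a b.
have H : \forall d \near (0:R)^'+,
    `[a, b] `<=` (fun x => forall y, `|x - y| <= d -> `|f x - f y| <= e).
  apply: covering => x _.
  have e2 : 0 < e / 2 by rewrite divr_gt0.
  have /cvgrPdist_le/(_ _ e2)/nbhs_ballP[r /= r0 Hr] := cf x.
  have r2 : 0 < r / 2 by rewrite divr_gt0.
  exists (ball x (r / 2), [set d | 0 < d < r / 2]).
    split => /=; first exact: nbhsx_ballx.
    near=> d; apply/andP; split => //; near: d; exact: nbhs_right_lt.
  move=> [z d] /= [xz /andP[d0 dr]] y zy.
  rewrite (splitr e) (le_trans (ler_distD (f x) _ _))// lerD//.
    rewrite distrC; apply: Hr; rewrite -ball_normE /=.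
    move: xz; rewrite -ball_normE /= => /lt_trans; apply; lra.
  apply: Hr; rewrite -ball_normE /=.
  rewrite (le_lt_trans (ler_distD z _ _))// (splitr r). apply: ltrD.
    by move: xz; rewrite -ball_normE /=.
  exact: le_lt_trans dr.
near (0:R)^'+ => d; exists d => // x y ax xb xy.
suff : `[a, b] `<=` (fun x => forall y, `|x - y| <= d -> `|f x - f y| <= e).
  by apply => //=; rewrite in_itv/= ax.
by near: d.
Unshelve. all: by end_near.
Qed.

(** The right-hand side has the shape accepted by [transport_close]. For [x] and [y] close, use
    uniform continuity if [|x|] is at most [A] and absorb the linear growth into [e * x^2]
    otherwise; for distant points, [L (x - y)^2] takes over. *)
Lemma linear_growth_modulus (f : R -> R) (K e : R) :
  continuous f -> (forall x, `|f x| <= K * (1 + `|x|)) -> 0 < e ->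
  exists2 L : R, 0 <= L & forall x y,
    `|f x - f y| <= e * (1 + x ^+ 2) + L * (x - y) ^+ 2.
Proof.
move=> cf Kf e0.
have K0 : 0 <= K.
  by have := Kf 0; rewrite normr0 addr0 mulr1; apply: le_trans.
have e1 : 0 <= e by exact: ltW.
(* If [|x| > A] and [|x - y| <= 1], the difference is at most [5 K |x|], and [5 K <= e |x|]. *)
pose A := 1 + 5 * K / e.
have A1 : 1 <= A by rewrite lerDl divr_ge0 ?mulr_ge0// ltW.
have [d1 d10 Hd1] := continuous_segment_modulus (- A) A cf e0.
pose d := Num.min d1 1.
have d0 : 0 < d by rewrite lt_min d10/=.
have dd1 : d <= d1 by rewrite ge_min lexx.
have d1' : 0 <= d by exact: ltW.
have d_le1 : d <= 1 by rewrite ge_min lexx orbT.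
(* Collects the constant [2 K] and the remainder of [2 K |x| <= e |x|^2 + K^2 / e]. *)
pose c0 := 2 * K + K ^+ 2 / e.
have c00 : 0 <= c0 by rewrite addr_ge0 ?mulr_ge0 ?invr_ge0 ?exprn_ge0.
exists (c0 / d ^+ 2 + K / d).
  by rewrite addr_ge0 ?mulr_ge0 ?invr_ge0 ?exprn_ge0.
move=> x y.
have sq2 : 0 <= (x - y) ^+ 2 by exact: sqr_ge0.
have L0 : 0 <= (c0 / d ^+ 2 + K / d) * (x - y) ^+ 2.
  by rewrite mulr_ge0// addr_ge0 ?mulr_ge0 ?invr_ge0 ?exprn_ge0.
have fxy : `|f x - f y| <= K * (2 + 2 * `|x| + `|x - y|).
  apply: le_trans (ler_normB _ _) _.
  have ny : `|y| <= `|x| + `|x - y|.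
    by rewrite {1}(_ : y = x - (x - y)) ?ler_normB//; ring.
  apply: le_trans (lerD (Kf x) (Kf y)) _.
  rewrite -mulrDr ler_wpM2l//; lra.
have x2 : x ^+ 2 = `|x| ^+ 2 by rewrite real_normK// num_real.
have xy2 : (x - y) ^+ 2 = `|x - y| ^+ 2 by rewrite real_normK// num_real.
have [xyd|dxy] := leP `|x - y| d.
  rewrite (@le_trans _ _ (e * (1 + x ^+ 2)))//; last by rewrite lerDl.
  have [xA|Ax] := leP `|x| A.
    move: xA; rewrite ler_norml => /andP[x1 x3].
    rewrite (le_trans (Hd1 _ _ x1 x3 (le_trans xyd dd1)))//.
    by rewrite ler_peMr ?lerDl ?sqr_ge0// ltW.
  apply: (le_trans fxy).
  have K5 : K * 5 <= e * `|x|.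
    rewrite -ler_pdivrMl// (le_trans _ (ltW Ax))// /A.
    by rewrite mulrC [K * 5]mulrC ler_wpDl.
  have x1 : 1 <= `|x| by exact: le_trans A1 (ltW Ax).
  apply: (@le_trans _ _ (K * 5 * `|x|)).
    rewrite -mulrA ler_wpM2l//; have := le_trans xyd d_le1; lra.
  rewrite (le_trans (ler_wpM2r _ K5))// x2 -mulrA -expr2.
  by rewrite ler_wpM2l ?(ltW e0)// lerDr.
apply: (le_trans fxy).
set a := `|x|; set t := `|x - y|.
have a0 : 0 <= a by exact: normr_ge0.
have t0 : 0 <= t by exact: normr_ge0.
rewrite x2 xy2 -/a -/t.
have td : 1 <= t / d by rewrite ler_pdivlMr// mul1r ltW.
have h1 : K * t <= K / d * t ^+ 2.
  rewrite (_ : K / d * t ^+ 2 = K * t * (t / d)); last by field; rewrite gt_eqF.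
  by rewrite ler_peMr// mulr_ge0.
have h2 : c0 <= c0 / d ^+ 2 * t ^+ 2.
  rewrite (_ : c0 / d ^+ 2 * t ^+ 2 = c0 * (t / d) ^+ 2); last by field; rewrite gt_eqF.
  by rewrite ler_peMr// exprn_ege1.
have h3 : 2 * K * a <= e * a ^+ 2 + K ^+ 2 / e.
  rewrite -subr_ge0 (_ : _ - _ = (e * a - K) ^+ 2 / e).
    by rewrite divr_ge0 ?sqr_ge0// ltW.
  by field; rewrite gt_eqF.
rewrite [(_ + K / d) * _]mulrDl.
move: h1 h2 h3; rewrite /c0.
set p := K / d * _; set q := (_ / d ^+ 2 * _); set k2 := K ^+ 2 / e; lra.
Qed.

End Moduli.

(** * Integrals and convolutions against measures with finite second moment *)

Section SecondMoments.
Context {R : realType}.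
Implicit Types (nu : borel_measure R) (f : R -> R).
Local Notation fint nu f :=
  (nu.-integrable setT (EFin \o (f : measurableTypeR R -> R))).

Definition mass_moment (q : R) nu :=
  nu setT = q%:E /\ (\int[nu]_x (x ^+ 2)%:E < +oo)%E.

Lemma mass_moment_ge0 q nu : mass_moment q nu -> 0 <= q.
Proof. by move=> [nuq _]; rewrite -lee_fin -nuq measure_ge0. Qed.

Lemma integrable_quadratic q nu f A B : mass_moment q nu -> continuous f ->
  (forall x, `|f x| <= A + B * x ^+ 2) -> fint nu f.
Proof.
move=> [nuq nu2] cf fAB.
have mf : measurable_fun [set: measurableTypeR R] f by exact: continuous_measurable_fun.
apply/integrableP; split; first exact/measurable_EFinP.
have m2 : measurable_fun [set: measurableTypeR R] (fun x : measurableTypeR R => (x ^+ 2 : R)).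
  by apply: measurable_funX.
apply: (@le_lt_trans _ _ (\int[nu]_x (cst (`|A|)%:E x + (`|B|)%:E * (x ^+ 2)%:E)))%E.
  apply: le_integral_pointwise => x _; rewrite /cst /= -EFinM -EFinD lee_fin.
  rewrite (le_trans (fAB x))// lerD ?ler_norm// ler_wpM2r ?sqr_ge0//.
  exact: ler_norm.
rewrite ge0_integralD//=; last 2 first.
- by move=> x _; rewrite mule_ge0// lee_fin sqr_ge0.
- by apply: measurable_funeM; exact/measurable_EFinP.
rewrite integral_cst// ge0_integralZl_EFin//; last 2 first.
- by move=> x _; rewrite lee_fin sqr_ge0.
- exact/measurable_EFinP.
rewrite [X in (_ * X)%E]nuq lte_add_pinfty//; first exact: ltry.
by apply: lte_mul_pinfty.
Qed.

Lemma Rintegral_const q nu (c : R) : mass_moment q nu -> \int[nu]_x c = c * q.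
Proof.
move=> [nuq _]; rewrite /Rintegral (_ : (fun _ => _) = cst c%:E)//.
by rewrite integral_cst// nuq.
Qed.

End SecondMoments.

Section ForceOfOneSpecies.
Context {R : realType}.
Implicit Types (nu : borel_measure R) (q : R).
Variables (f : R -> R) (K : R).
Hypothesis cf : continuous f.
Hypothesis f_growth : forall x, `|f x| <= K * (1 + `|x|).

Let K_ge0 : 0 <= K.
Proof. by have := f_growth 0; rewrite normr0 addr0 mulr1; apply: le_trans. Qed.

Lemma continuous_reflect x : continuous (fun y => f (x - y)).
Proof.
move=> y; apply: (@continuous_comp _ _ _ (fun y => x - y) f); last exact: cf.
by apply: continuousB; [exact: cst_continuous|exact: cvg_id].
Qed.

Lemma sqr_normr_le (y : R) : `|y| <= 1 + y ^+ 2.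
Proof.
have := sqr_ge0 (`|y| - 2^-1); rewrite -[y ^+ 2](real_normK (num_real y)).
by lra.
Qed.

Lemma growth_reflect x y : `|f (x - y)| <= K * (2 + `|x|) + K * y ^+ 2.
Proof.
apply: le_trans (f_growth _) _; rewrite -mulrDr ler_wpM2l//.
have := ler_normB x y; have := sqr_normr_le y; lra.
Qed.

Lemma integrable_reflect q nu x : mass_moment q nu ->
  nu.-integrable setT (EFin \o (fun y => f (x - y))).
Proof.
move=> nuq; apply: (integrable_quadratic nuq (@continuous_reflect x)).
exact: growth_reflect.
Qed.

(** Joint continuity in the measure and the point. The weight [1 + (x - z)^2] of the modulus is
    integrated against the fixed measure [nu] only, so the estimate is uniform in [nu']. *)
Lemma convolution_continuous q nu x (e : R) : mass_moment q nu -> 0 < e ->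
  \forall d \near 0^'+, forall nu' x', mass_moment q nu' ->
    transport_close d nu' nu -> transport_close d nu nu' -> `|x' - x| <= d ->
    `|\int[nu']_y f (x' - y) - \int[nu]_y f (x - y)| <= e.
Proof.
move=> nuq e0; have q0 := mass_moment_ge0 nuq.
pose h z : R := 1 + (x - z) ^+ 2.
have ch : continuous h.
  rewrite (_ : h = horner (1 + (x%:P - 'X) ^+ 2)); first exact: continuous_horner.
  by apply/funext => z; rewrite !hornerE.
have ih : nu.-integrable setT (EFin \o h).
  apply: (integrable_quadratic (A := 1 + 2 * x ^+ 2) (B := 2) nuq ch) => z.
  rewrite ger0_norm ?addr_ge0 ?sqr_ge0//.
  by have := sqr_ge0 (x + z); rewrite /h !expr2; lra.
set B := \int[nu]_z h z.
have B0 : 0 <= B by apply: Rintegral_ge0 => z _; rewrite addr_ge0// sqr_ge0.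
pose e1 := e / 2 / (B + 1).
have e10 : 0 < e1 by rewrite !divr_gt0// ltr_wpDl.
have [L L0 HL] := linear_growth_modulus cf f_growth e10.
have Lq0 : 0 < 2 * L * (q + 1) + 1 by rewrite ltr_wpDl// !mulr_ge0// addr_ge0.
near=> d => nu' x' nu'q c1 c2 x'x.
have d0 : 0 < d by [].
have d1 : d <= 1 by near: d; exact: nbhs_right_le.
(* Half of [e] pays for [e1 * B]; the other half pays for the displacement of the point, at most
   [2 L d q] since [d <= 1], and for the transport cost [2 L d]. *)
have de : d <= e / 2 / (2 * L * (q + 1) + 1).
  by near: d; apply: nbhs_right_le; rewrite !divr_gt0.
have i1 := @integrable_reflect _ _ x nuq.
have i2 := @integrable_reflect _ _ x' nu'q.
pose c := 2 * L * (x - x') ^+ 2.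
have icc : nu.-integrable setT (EFin \o (fun _ : R => c)).
  apply: (integrable_quadratic (A := `|c|) (B := 0) nuq); first exact: cst_continuous.
  by move=> z; rewrite mul0r addr0.
have ie : nu.-integrable setT (EFin \o (fun z => e1 * h z)).
  exact: (integrableZl measurableT e1 ih).
have ic1 : nu.-integrable setT (EFin \o (fun z => e1 * h z + c)).
  exact: (integrableD measurableT ie icc).
have ic (s : R) : nu.-integrable setT (EFin \o (fun z => s * (e1 * h z + c))).
  exact: (integrableZl measurableT s ic1).
have Ic : \int[nu]_z (e1 * h z + c) = e1 * B + c * q.
  by rewrite RintegralD// RintegralZl// (Rintegral_const _ nuq).
have cross y z : `|f (x - z) - f (x' - y)| <= e1 * h z + c + 2 * L * (y - z) ^+ 2.
  apply: le_trans (HL _ _) _.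
  have -> : e1 * h z + c + 2 * L * (y - z) ^+ 2 =
      e1 * (1 + (x - z) ^+ 2) + L * (2 * (x - x') ^+ 2 + 2 * (y - z) ^+ 2).
    by rewrite /h /c; ring.
  rewrite lerD2l ler_wpM2l//.
  by have := sqr_ge0 ((x - x') - (y - z)); rewrite !expr2; lra.
have K0 : 0 <= 2 * L by rewrite mulr_ge0.
have total : e1 * B + c * q + 2 * L * d <= e.
  have s1 : e1 * B <= e / 2.
    rewrite /e1 mulrAC ler_pdivrMr ?ltr_wpDl//.
    by apply: ler_wpM2l; [rewrite divr_ge0// ltW|rewrite lerDl].
  have s2 : c <= 2 * L * d.
    rewrite /c ler_wpM2l// -[_ ^+ 2]real_normK ?num_real// distrC.
    rewrite expr2 -[leRHS]mulr1 ler_pM//.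
    exact: le_trans x'x d1.
  have s3 : c * q <= 2 * L * d * q by rewrite ler_wpM2r.
  have s4 : d * (2 * L * (q + 1) + 1) <= e / 2 by rewrite -ler_pdivlMr.
  have := ltW d0; move: s1 s3 s4; set u := e1 * B; set v := c * q.
  rewrite !mulrDr !mulr1; set r := 2 * L.
  rewrite [r * d * q]mulrAC [d * (r * q)]mulrC [d * r]mulrC; lra.
have up : \int[nu']_y f (x' - y) <= \int[nu]_z f (x - z) + e.
  have := c1 (fun y => f (x' - y)) (fun z => f (x - z) + 1 * (e1 * h z + c)) (2 * L) i2.
  move=> /(_ (integrableD measurableT i1 (ic 1)) K0) H.
  have {}H := H _.
  apply: le_trans (H _) _.
    move=> y z; have := cross y z; rewrite distrC mul1r => /(le_trans (ler_norm _)).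
    lra.
  rewrite (RintegralD measurableT i1 (ic 1)) RintegralZl// mul1r.
  by rewrite Ic -addrA lerD2l.
(* As [transport_close] is one-sided, the lower bound uses the reverse direction, with the error
   subtracted from the function integrated against [nu]. *)
have lo : \int[nu]_z f (x - z) - e <= \int[nu']_y f (x' - y).
  have := c2 (fun z => f (x - z) + (-1) * (e1 * h z + c)) (fun y => f (x' - y)) (2 * L).
  move=> /(_ (integrableD measurableT i1 (ic (-1))) i2 K0) H.
  have {}H := H _.
  rewrite lerBlDr; apply: (@le_trans _ _ ((\int[nu']_y f (x' - y) + 2 * L * d) +
    (e1 * B + c * q))); last first.
    by rewrite -addrA lerD2l addrC.
  rewrite -lerBlDr; apply: le_trans (H _); last first.
    move=> z y; have := cross y z => /(le_trans (ler_norm _)).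
    rewrite mulN1r -[(z - y) ^+ 2]sqrrN opprB; lra.
  rewrite (RintegralD measurableT i1 (ic (-1))).
  by rewrite lerD2l RintegralZl// Ic mulN1r.
by rewrite ler_distl lo up.
Unshelve. all: by end_near.
Qed.

(** Second moments are bounded on a transport neighbourhood of [nu], because
    [y^2 <= 2 z^2 + 2 (y - z)^2]; the linear growth of [f] does the rest. *)
Lemma convolution_growth q nu : mass_moment q nu ->
  exists C : R, forall nu' x, mass_moment q nu' -> transport_close 1 nu' nu ->
    `|\int[nu']_y f (x - y)| <= C * (1 + `|x|).
Proof.
move=> nuq; have q0 := mass_moment_ge0 nuq.
have isq nu' : mass_moment q nu' -> nu'.-integrable setT (EFin \o (fun x : R => x ^+ 2)).
  move=> nu'q; apply: (integrable_quadratic (A := 0) (B := 1) nu'q).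
    exact: exprn_continuous.
  by move=> x; rewrite add0r mul1r ger0_norm// sqr_ge0.
have i2sq nu' : mass_moment q nu' -> nu'.-integrable setT (EFin \o (fun x : R => 2 * x ^+ 2)).
  by move=> nu'q; exact: (integrableZl _ _ (isq _ nu'q)).
pose M := \int[nu]_z (2 * z ^+ 2).
have M0 : 0 <= M by apply: Rintegral_ge0 => z _; rewrite mulr_ge0// sqr_ge0.
exists (K * (2 * q + M + 2)) => nu' x nu'q cl.
have M' : \int[nu']_y (y ^+ 2) <= M + 2 * 1.
  apply: (cl _ _ _ (isq _ nu'q) (i2sq _ nuq)) => // y z.
  by have := sqr_ge0 (y - 2 * z); rewrite !expr2; lra.
apply: le_trans (le_normr_Rintegral _ (integrable_reflect x nu'q)) _ => //.
have ic : nu'.-integrable setT (EFin \o (fun _ : R => K * (2 + `|x|))).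
  apply: (integrable_quadratic (A := `|K * (2 + `|x|)|) (B := 0) nu'q); first exact: cst_continuous.
  by move=> z; rewrite mul0r addr0.
have ik : nu'.-integrable setT (EFin \o (fun y : R => K * y ^+ 2)).
  by exact: (integrableZl _ _ (isq _ nu'q)).
apply: (@le_trans _ _ (\int[nu']_y (K * (2 + `|x|) + K * y ^+ 2))).
  apply: le_Rintegral => //.
  - exact: (integrable_norm (integrable_reflect x nu'q)).
  - exact: (integrableD measurableT ic ik).
  - by move=> y _; exact: growth_reflect.
rewrite (RintegralD measurableT ic ik) (Rintegral_const _ nu'q).
have isq' := isq _ nu'q; rewrite RintegralZl//.
rewrite -[K * _ * q]mulrA -mulrDr -[leRHS]mulrA.
apply: ler_wpM2l => //.
apply: (@le_trans _ _ ((2 + `|x|) * q + (M + 2))); first by rewrite lerD2l (le_trans M')// mulr1.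
have := normr_ge0 x; set a := `|x| => a0.
have := mulr_ge0 a0 q0; have := mulr_ge0 a0 M0; lra.
Qed.

End ForceOfOneSpecies.

Section InteractionForce.
Context {R : realType} {n : nat}.
Variables (m p : 'I_n -> R) (E : R) (W : R -> 'M[R]_n) (kappa : 'M[R]_n).
Hypothesis W_adm : admissible_potential W kappa.

Lemma state_space_mass_moment mu j :
  state_space m p E mu -> mass_moment (p j) (mu j).
Proof. by case=> mass moment _; split; [exact: mass|exact: moment]. Qed.

Lemma admissible_derive1_continuous i j : continuous (derive1 (entry W i j)).
Proof. by have [_ /(_ i j)[]] := W_adm. Qed.

Lemma admissible_derive1_growth i j :
  exists K, forall x, `|derive1 (entry W i j) x| <= K * (1 + `|x|).
Proof.
have [_ W1 _ [Wbar HW] [_ cvx]] := W_adm.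
exact: (semiconvex_derive1_growth (W1 i j) (fun z => HW z i j) (cvx i j)).
Qed.

(** Each [j] contributes [kappa i j * (x - y)] times the mass [p j]; this is where the rate [S_i]
    comes from. *)
Lemma interaction_force_mono mu i x y : state_space m p E mu -> y <= x ->
  (\sum_j kappa i j * p j) * (x - y) <=
  interaction_force W mu i x - interaction_force W mu i y.
Proof.
move=> muP yx; rewrite /interaction_force -sumrB mulr_suml; apply: ler_sum => j _.
have mj := state_space_mass_moment j muP.
have cf := @admissible_derive1_continuous i j.
have [K HK] := admissible_derive1_growth i j.
have i1 := integrable_reflect cf HK x mj.
have i2 := integrable_reflect cf HK y mj.
rewrite -(RintegralB measurableT i1 i2) mulrAC -(Rintegral_const _ mj).
apply: le_Rintegral => //.
- apply: (integrable_quadratic (A := `|kappa i j * (x - y)|) (B := 0) mj).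
    exact: cst_continuous.
  by move=> z; rewrite mul0r addr0.
- exact: (integrableB measurableT i1 i2).
- move=> z _; have [->|xNy] := eqVneq x y; first by rewrite !subrr mulr0.
  have xy0 : 0 < x - y by rewrite subr_gt0 lt_neqAle eq_sym xNy.
  have [_ W1 _ _ [_ cvx]] := W_adm.
  have := semiconvex_derive1_mono (W1 i j) (cvx i j) (x - z) (y - z).
  have -> : x - z - (y - z) = x - y by ring.
  by rewrite expr2 mulrA ler_pM2r.
Qed.

Lemma interaction_force_continuous mu i x e : state_space m p E mu -> 0 < e ->
  exists2 d : R, 0 < d & forall mu' x', state_space m p E mu' ->
    (forall j, transport_close d (mu' j) (mu j)) ->
    (forall j, transport_close d (mu j) (mu' j)) -> `|x' - x| <= d ->
    `|interaction_force W mu' i x' - interaction_force W mu i x| <= e.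
Proof.
move=> muP e0.
have en0 : 0 < e / n.+1%:R by rewrite divr_gt0.
have : \forall d \near (0:R)^'+, forall j, forall nu' x', mass_moment (p j) nu' ->
    transport_close d nu' (mu j) -> transport_close d (mu j) nu' -> `|x' - x| <= d ->
    `|\int[nu']_y derive1 (entry W i j) (x' - y) -
      \int[mu j]_y derive1 (entry W i j) (x - y)| <= e / n.+1%:R.
  apply: filter_forall => j.
  have [K HK] := admissible_derive1_growth i j.
  exact: (convolution_continuous (@admissible_derive1_continuous i j) HK x
            (state_space_mass_moment j muP) en0).
move=> H; near (0:R)^'+ => d.
exists d => // mu' x' mu'P c1 c2 x'x.
rewrite /interaction_force -sumrB; apply: le_trans (ler_norm_sum _ _ _) _.
apply: (@le_trans _ _ (\sum_(j < n) e / n.+1%:R)).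
  apply: ler_sum => j _.
  have Hd : forall j, forall nu' x', mass_moment (p j) nu' ->
    transport_close d nu' (mu j) -> transport_close d (mu j) nu' -> `|x' - x| <= d ->
    `|\int[nu']_y derive1 (entry W i j) (x' - y) -
      \int[mu j]_y derive1 (entry W i j) (x - y)| <= e / n.+1%:R by near: d.
  exact: Hd (state_space_mass_moment j mu'P) (c1 j) (c2 j) x'x.
rewrite sumr_const card_ord -[leLHS]mulr_natr mulrAC ler_pdivrMr//.
by rewrite ler_pM2l// ler_nat.
Unshelve. all: by end_near.
Qed.

Lemma interaction_force_growth mu i : state_space m p E mu ->
  exists C : R, forall mu' x, state_space m p E mu' ->
    (forall j, transport_close 1 (mu' j) (mu j)) ->
    `|interaction_force W mu' i x| <= C * (1 + `|x|).
Proof.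
move=> muP.
have /choice[C HC] : forall j, exists C : R, forall nu' x, mass_moment (p j) nu' ->
    transport_close 1 nu' (mu j) ->
    `|\int[nu']_y derive1 (entry W i j) (x - y)| <= C * (1 + `|x|).
  move=> j; have [K HK] := admissible_derive1_growth i j.
  exact: (convolution_growth (@admissible_derive1_continuous i j) HK
            (state_space_mass_moment j muP)).
exists (\sum_j C j) => mu' x mu'P cl.
rewrite /interaction_force mulr_suml.
apply: le_trans (ler_norm_sum _ _ _) _; apply: ler_sum => j _.
exact: HC (state_space_mass_moment j mu'P) (cl j).
Qed.

End InteractionForce.

(** * Barriers *)

Section Cutoffs.
Context {R : realType}.
Implicit Types x y : R.
Local Notation h := (flat (1 : {poly R})).
Local Notation h' := (flat (flat_deriv (1 : {poly R}))).

Lemma flat_deriv1 : flat_deriv (1 : {poly R}) = 'X^2.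
Proof. by rewrite /flat_deriv -polyC1 derivC subr0 polyC1 mul1r. Qed.

Lemma flat_le0 p x : x <= 0 -> flat p x = 0 :> R.
Proof. by move=> x0; rewrite /flat ltNge x0. Qed.

Lemma flat1_gt0 x : 0 < x -> 0 < h x.
Proof. by move=> x0; rewrite /flat x0 -polyC1 hornerC mul1r expR_gt0. Qed.

Lemma flat1_ge0 x : 0 <= h x.
Proof.
have [x0|x0] := leP x 0; first by rewrite flat_le0.
exact: ltW (flat1_gt0 x0).
Qed.

Lemma flat1_le1 x : h x <= 1.
Proof.
have [x0|x0] := leP x 0; first by rewrite flat_le0.
by rewrite /flat x0 -polyC1 hornerC mul1r -expR0 ler_expR oppr_le0 invr_ge0 ltW.
Qed.

Lemma flat1_mono x y : x <= y -> h x <= h y.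
Proof.
move=> xy; have [x0|x0] := leP x 0; first by rewrite flat_le0// flat1_ge0.
have y0 : 0 < y by exact: lt_le_trans xy.
rewrite /flat x0 y0 -polyC1 !hornerC !mul1r ler_expR lerN2.
by rewrite lef_pV2// posrE.
Qed.

Lemma flat1_derivE x : 0 < x -> h' x = x ^- 2 * h x.
Proof. by move=> x0; rewrite flat_deriv1 /flat x0 -polyC1 hornerC hornerXn mul1r exprVn. Qed.

Lemma flat1_deriv_ge0 x : 0 <= h' x.
Proof.
have [x0|x0] := leP x 0; first by rewrite flat_le0.
by rewrite flat1_derivE// mulr_ge0 ?flat1_ge0// invr_ge0 exprn_ge0// ltW.
Qed.

Lemma flat1_lipschitz : exists2 L : R, 0 <= L & forall x y, `|h x - h y| <= L * `|x - y|.
Proof.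
have [L HL] := flat_bounded (flat_deriv (1 : {poly R})).
have L0 : 0 <= L by exact: le_trans (HL 0).
exists L => // x y.
wlog yx : x y / y < x.
  have [xy|xy|->] := ltgtP x y => H; last by rewrite !subrr normr0 mulr0.
    by rewrite distrC [`|x - y|]distrC; exact: H.
  exact: H.
have dh (z : R) : is_derive z 1 h (h' z) := is_derive_flat 1 z.
have [|c _ ->] := @MVT R h h' y x yx (fun z _ => dh z).
  apply: derivable_within_continuous => z _.
  by have [] := dh z.
by rewrite normrM ler_wpM2r.
Qed.

(* A smooth step, built by composition so that it is an [sexpr]; the usual
   quotient [h y / (h y + h (1 - y))] is not. *)
Definition step_up y := h (h 1 - h (1 - y)).
Definition step_up' y := h' (h 1 - h (1 - y)) * h' (1 - y).

Lemma step_up_le0 y : y <= 0 -> step_up y = 0 /\ step_up' y = 0.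
Proof.
move=> y0; have l : h 1 - h (1 - y) <= 0.
  by rewrite subr_le0 flat1_mono// lerBrDr gerDl.
by rewrite /step_up /step_up' !(flat_le0 _ l) mul0r.
Qed.

Lemma step_up_ge1 y : 1 <= y -> step_up y = h (h 1) /\ step_up' y = 0.
Proof.
move=> y1; have l : 1 - y <= 0 by rewrite subr_le0.
by rewrite /step_up /step_up' !(flat_le0 _ l) subr0 mulr0.
Qed.

Lemma step_up_ge0 y : 0 <= step_up y. Proof. exact: flat1_ge0. Qed.

Lemma step_up'_bounded : exists2 C : R, 0 <= C & forall y, 0 <= step_up' y <= C.
Proof.
have [L HL] := flat_bounded (flat_deriv (1 : {poly R})).
have L0 : 0 <= L by exact: le_trans (HL 0).
exists (L * L); first exact: mulr_ge0.
move=> y; rewrite mulr_ge0 ?flat1_deriv_ge0//=.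
by apply: ler_pM; rewrite ?flat1_deriv_ge0// (le_trans (ler_norm _)).
Qed.

End Cutoffs.

Section BarrierTestFunction.
Context {R : realType}.
Variables (s T K b b1 c c1 : R).
Local Notation h := (flat (1 : {poly R})).
Local Notation h' := (flat (flat_deriv (1 : {poly R}))).

Definition affine_expr (a a1 : R) : sexpr :=
  SAdd (SCst (a - a1 * s)) (SMul (SCst a1) STime).
Definition sopp (e : @sexpr R) : sexpr := SMul (SCst (-1)) e.

Definition barrier_time : sexpr :=
  SMul (SFlat 1 (SAdd (SCst (h 1))
     (sopp (SFlat 1 (SAdd (SCst (2 + K * s)) (SMul (SCst (- K)) STime))))))
   (SFlat 1 (SAdd (SCst T) (sopp STime))).

Definition barrier_space : sexpr :=
  SMul (SFlat 1 (SAdd SSpace (sopp (affine_expr b b1))))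
       (SFlat 1 (SAdd (affine_expr c c1) (sopp SSpace))).

Definition barrier_expr : sexpr := SMul barrier_time barrier_space.

(** Rises between [s + 1/K] and [s + 2/K], then decreases to 0 at [T]. The shift by 1 keeps its
    support away from time 0 even when [s = 0]. *)
Definition barrier_cutoff r := step_up (K * (r - s) - 1) * h (T - r).
Definition barrier_cutoff' r :=
  K * step_up' (K * (r - s) - 1) * h (T - r) -
  step_up (K * (r - s) - 1) * h' (T - r).
Definition beta r := b + b1 * (r - s).
Definition rho r := c + c1 * (r - s).
Definition barrier_profile r x := h (x - beta r) * h (rho r - x).

Lemma seval_barrier r x :
  seval barrier_expr (r, x) = barrier_cutoff r * barrier_profile r x.
Proof.
rewrite /barrier_cutoff /barrier_profile /step_up /beta /rho /=.
by congr (h _ * h _ * (h _ * h _)); [congr (_ + _); rewrite mulN1r; congr (- h _)|..]; ring.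
Qed.

Lemma seval_barrier_time_derivative r x :
  seval (sderive true barrier_expr) (r, x) =
  barrier_cutoff' r * barrier_profile r x +
  barrier_cutoff r * (c1 * h' (rho r - x) * h (x - beta r) -
                      b1 * h' (x - beta r) * h (rho r - x)).
Proof.
rewrite /barrier_cutoff /barrier_cutoff' /barrier_profile /step_up /step_up' /=.
have -> : h 1 + -1 * h (2 + K * s + - K * r) = h 1 - h (1 - (K * (r - s) - 1)).
  by rewrite mulN1r; congr (_ - h _); ring.
have -> : 2 + K * s + - K * r = 1 - (K * (r - s) - 1) by ring.
have -> : x + -1 * (b - b1 * s + b1 * r) = x - beta r by rewrite /beta; ring.
have -> : c - c1 * s + c1 * r + -1 * x = rho r - x by rewrite /rho; ring.
have -> : T + -1 * r = T - r by ring.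
ring.
Qed.

Lemma seval_barrier_space_derivative r x :
  seval (sderive false barrier_expr) (r, x) =
  barrier_cutoff r * (h' (x - beta r) * h (rho r - x) -
                      h' (rho r - x) * h (x - beta r)).
Proof.
rewrite /barrier_cutoff /step_up /=.
have -> : h 1 + -1 * h (2 + K * s + - K * r) = h 1 - h (1 - (K * (r - s) - 1)).
  by rewrite mulN1r; congr (_ - h _); ring.
have -> : 2 + K * s + - K * r = 1 - (K * (r - s) - 1) by ring.
have -> : x + -1 * (b - b1 * s + b1 * r) = x - beta r by rewrite /beta; ring.
have -> : c - c1 * s + c1 * r + -1 * x = rho r - x by rewrite /rho; ring.
have -> : T + -1 * r = T - r by ring.
ring.
Qed.

Lemma barrier_cutoff_eq0 r : 0 < K -> (r <= s + K^-1) || (T <= r) ->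
  barrier_cutoff r = 0 /\ barrier_cutoff' r = 0.
Proof.
move=> K0 /orP[rs|Tr]; rewrite /barrier_cutoff /barrier_cutoff'.
  have l : K * (r - s) - 1 <= 0.
    by rewrite subr_le0 -ler_pdivlMl// mulr1 lerBlDl.
  by rewrite !(step_up_le0 l).1 !(step_up_le0 l).2 !(mulr0, mul0r, subr0).
have l : T - r <= 0 by rewrite subr_le0.
by rewrite !(flat_le0 _ l) !mulr0 subr0.
Qed.

Lemma barrier_cutoff_ge0 r : 0 <= barrier_cutoff r.
Proof. by rewrite mulr_ge0 ?step_up_ge0 ?flat1_ge0. Qed.

Lemma barrier_profile_ge0 r x : 0 <= barrier_profile r x.
Proof. by rewrite mulr_ge0 ?flat1_ge0. Qed.

Lemma barrier_profile_le1 r x : barrier_profile r x <= 1.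
Proof. by rewrite -[1]mulr1 ler_pM ?flat1_ge0 ?flat1_le1. Qed.

Lemma barrier_profile_gt0 r x :
  (0 < barrier_profile r x) = (beta r < x < rho r).
Proof.
apply/idP/idP => [|/andP[h1 h2]]; last by rewrite mulr_gt0// flat1_gt0 ?subr_gt0.
rewrite /barrier_profile; have [h1|h1] := leP (x - beta r) 0.
  by rewrite flat_le0// mul0r ltxx.
have [h2|h2] := leP (rho r - x) 0; first by rewrite [h (rho r - x)]flat_le0// mulr0 ltxx.
by move: h1 h2; rewrite !subr_gt0 => -> ->.
Qed.

Lemma continuous_barrier_profile r : continuous (barrier_profile r).
Proof.
have ch : continuous h.
  by move=> x; apply/differentiable_continuous/differentiable_flat.
move=> x; apply: (@continuousM _ _ (fun x => h (x - beta r)) (fun x => h (rho r - x))).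
  apply: (@continuous_comp _ _ _ (fun x => x - beta r) h); last exact: ch.
  by apply: continuousB; [exact: cvg_id|exact: cst_continuous].
apply: (@continuous_comp _ _ _ (fun x => rho r - x) h); last exact: ch.
by apply: continuousB; [exact: cst_continuous|exact: cvg_id].
Qed.

Lemma test_function_barrier : 0 <= s -> 0 < K ->
  test_function (seval barrier_expr).
Proof.
move=> s0 K0.
pose B := `|b| + `|b1| * `|T - s|; pose C := `|c| + `|c1| * `|T - s|.
apply: (@test_function_seval _ _ (s + K^-1) T (- B) C).
  by rewrite ltr_wpDl// invr_gt0.
move=> [r x]; rewrite seval_barrier => /= fN0.
have [rs|rs] := leP r (s + K^-1).
  by move: fN0; rewrite (barrier_cutoff_eq0 K0 _).1 ?rs// mul0r eqxx.
have [Tr|rT] := leP T r.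
  by move: fN0; rewrite (barrier_cutoff_eq0 K0 _).1 ?Tr ?orbT// mul0r eqxx.
have : 0 < barrier_profile r x.
  rewrite lt_neqAle barrier_profile_ge0 andbT eq_sym.
  by apply: contra_neq fN0 => ->; rewrite mulr0.
rewrite barrier_profile_gt0 => /andP[bx xc].
have sr : s < r by rewrite (lt_trans _ rs)// ltrDl invr_gt0.
have rsT : `|r - s| <= `|T - s|.
  by rewrite !ger0_norm ?subr_ge0 ?lerD2r; have := lt_trans sr rT; lra.
have bnd (a a1 : R) : `|a + a1 * (r - s)| <= `|a| + `|a1| * `|T - s|.
  by rewrite (le_trans (ler_normD _ _))// lerD2l normrM ler_wpM2l.
split; [exact: ltW|exact: ltW|..].
- by have := bnd b b1; rewrite ler_norml => /andP[h _]; exact: le_trans h (ltW bx).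
- by have := bnd c c1; rewrite ler_norml => /andP[_ h]; exact: le_trans (ltW xc) h.
Qed.

Lemma barrier_transport_le r x v :
  (beta r < x -> v <= b1) -> (x < rho r -> c1 <= v) ->
  seval (sderive true barrier_expr) (r, x) +
    v * seval (sderive false barrier_expr) (r, x) <=
  barrier_cutoff' r * barrier_profile r x.
Proof.
move=> vb vc; rewrite seval_barrier_time_derivative seval_barrier_space_derivative.
have -> : barrier_cutoff' r * barrier_profile r x +
    barrier_cutoff r * (c1 * h' (rho r - x) * h (x - beta r) -
                        b1 * h' (x - beta r) * h (rho r - x)) +
    v * (barrier_cutoff r * (h' (x - beta r) * h (rho r - x) -
                             h' (rho r - x) * h (x - beta r))) =
  barrier_cutoff' r * barrier_profile r x - barrier_cutoff r *
   (h' (x - beta r) * h (rho r - x) * (b1 - v) +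
    h' (rho r - x) * h (x - beta r) * (v - c1)) by ring.
rewrite gerBl mulr_ge0 ?barrier_cutoff_ge0// addr_ge0//.
- have [xb|bx] := leP x (beta r).
    by rewrite [h' (x - _)]flat_le0 ?subr_le0// !mul0r.
  by rewrite !mulr_ge0 ?flat1_deriv_ge0 ?flat1_ge0// subr_ge0 vb.
- have [xc|cx] := leP (rho r) x.
    by rewrite [h' (rho _ - _)]flat_le0 ?subr_le0// !mul0r.
  by rewrite !mulr_ge0 ?flat1_deriv_ge0 ?flat1_ge0// subr_ge0 vc.
Qed.

End BarrierTestFunction.

Section StepIntegral.
Context {R : realType}.

(** The interval [[t0, t1]] lies in the domain, so its measure there is exact; [[s, s + w]] may
    stick out, so its measure is only bounded, which suffices as [0 <= c1]. *)
Lemma integral_le_steps (F : R -> \bar R) (s w t0 t1 c1 c2 : R) :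
  0 <= w -> 0 <= c1 -> 0 < t0 -> t0 <= t1 ->
  (forall r : R, 0 < r ->
    (F r <= (c1 * \1_`[s, (s + w)] r - c2 * \1_`[t0, t1] r)%:E)%E) ->
  (\int[lebesgue_measure]_(r in `]0%R, +oo[) F r <= (c1 * w - c2 * (t1 - t0))%:E)%E.
Proof.
move=> w0 c10 t00 t01 HF.
pose D : set R := `]0, +oo[%classic.
have mD : measurable (D : set (measurableTypeR R)) by exact: measurable_itv.
apply: (@le_trans _ _ (\int[lebesgue_measure]_(r in D)
   ((c1 * \1_`[s, (s + w)] r)%:E - (c2 * \1_`[t0, t1] r)%:E)))%E.
  apply: le_integral_pointwise => r; rewrite /D /= in_itv/= andbT => r0.
  by rewrite -EFinB; exact: HF.
have ii (a b : R) : lebesgue_measure.-integrable D (EFin \o (\1_`[a, b] : R -> R)).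
  apply: (@integrableS _ _ _ _ setT) => //.
  exact: integrable_indic_itv.
have iz (k a b : R) : lebesgue_measure.-integrable D (EFin \o (fun r => k * \1_`[a, b] r)).
  exact: (integrableZl mD k (ii a b)).
rewrite integralB_EFin//.
have mi (k a b : R) : (\int[lebesgue_measure]_(r in D) (k * \1_`[a, b] r)%:E =
    k%:E * lebesgue_measure (`[a, b] `&` D))%E.
  under eq_integral do rewrite EFinM.
  by rewrite integralZl// ?integral_indic//; exact: ii.
rewrite !mi EFinB leeB//.
  rewrite EFinM lee_wpmul2l ?lee_fin//.
  apply: (@le_trans _ _ (lebesgue_measure `[s, (s + w)])).
    by apply: le_measure; rewrite ?inE//; exact: measurableI.
  rewrite lebesgue_measure_itv/= lte_fin; case: ifPn => _; last by rewrite lee_fin.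
  by rewrite -EFinB lee_fin addrC addKr.
rewrite EFinM (_ : `[t0, t1] `&` D = `[t0, t1]%classic); last first.
  apply/setIidl => r; rewrite /D /= !in_itv/= andbT => /andP[+ _].
  exact: lt_le_trans.
rewrite [X in (_ <= _ * X)%E](lebesgue_measure_itv `[t0, t1])/= lte_fin.
case: ltP => t10; first by rewrite -EFinB.
by rewrite (_ : t1 = t0) ?subrr//; apply/eqP; rewrite eq_le t01 t10.
Qed.

End StepIntegral.

(** * Mass between two affine barriers for a continuity equation with decreasing velocity *)

Section ContinuityEquation.
Context {R : realType}.
Variables (nu : R -> borel_measure R) (q : R) (v : R -> R -> R).
Hypothesis nu_mass : forall t : R, 0 <= t -> mass_moment q (nu t).
Hypothesis nu_close : forall T e : R, 0 < T -> 0 < e -> exists2 d : R, 0 < d &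
  forall s t : R, 0 <= s -> s <= T -> 0 <= t -> t <= T -> `|s - t| <= d ->
  transport_close e (nu s) (nu t).
Hypothesis nu_continuity : forall f, test_function f ->
  (\int[lebesgue_measure]_(t in `]0%R, +oo[) \int[nu t]_x
     ('D_(direction true) f (t, x) + v t x * 'D_(direction false) f (t, x))%:E
   = 0)%E.
Hypothesis v_decr : forall t x y : R, 0 <= t -> y <= x -> v t x <= v t y.

Section Barrier.
Variables (s T b b1 c c1 : R).
Hypothesis s_ge0 : 0 <= s.
Hypothesis beta_super : forall r, s < r -> r < T -> v r (beta s b b1 r) <= b1.
Hypothesis rho_sub : forall r, s < r -> r < T -> c1 <= v r (rho s c c1 r).
Hypothesis nu_start : nu s `]b, c[%classic = 0%E.

Let g r := barrier_profile s b b1 c c1 r.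
Let G r := \int[nu r]_x g r x.

Lemma profile_integrable r t : 0 <= t ->
  (nu t).-integrable setT (EFin \o (g r : measurableTypeR R -> R)).
Proof.
move=> t0; apply: (integrable_quadratic (A := 1) (B := 0) (nu_mass t0)).
  exact: continuous_barrier_profile.
move=> x; rewrite mul0r addr0 ger0_norm ?barrier_profile_ge0//.
exact: barrier_profile_le1.
Qed.

(** The profile is Lipschitz in time and space; the term linear in [|x - y|] is traded for [e] plus
    a quadratic one, as [transport_close] demands. *)
Lemma profile_modulus e : 0 < e -> exists L M : R, [/\ 0 <= L, 0 <= M &
  forall r t x y, g r x <= g t y + e + M * `|r - t| + L * (x - y) ^+ 2].
Proof.
move=> e0; have [L0 L00 HL] := @flat1_lipschitz R.
exists (L0 ^+ 2 / e), (L0 * (`|b1| + `|c1|)); split.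
- by rewrite divr_ge0 ?sqr_ge0// ltW.
- by rewrite mulr_ge0// addr_ge0.
move=> r t x y.
set P := fun r x => flat (1 : {poly R}) (x - beta s b b1 r).
set Q := fun r x => flat (1 : {poly R}) (rho s c c1 r - x).
have gE r' x' : g r' x' = P r' x' * Q r' x' by [].
have p1 : `|P r x - P t y| <= L0 * (`|x - y| + `|b1| * `|r - t|).
  apply: le_trans (HL _ _) _; rewrite ler_wpM2l//.
  have -> : x - beta s b b1 r - (y - beta s b b1 t) = (x - y) - b1 * (r - t).
    by rewrite /beta; ring.
  by rewrite (le_trans (ler_normB _ _))// normrM.
have q1 : `|Q r x - Q t y| <= L0 * (`|x - y| + `|c1| * `|r - t|).
  apply: le_trans (HL _ _) _; rewrite ler_wpM2l//.
  have -> : rho s c c1 r - x - (rho s c c1 t - y) = - (x - y) + c1 * (r - t).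
    by rewrite /rho; ring.
  by rewrite (le_trans (ler_normD _ _))// normrM normrN.
have d1 : g r x - g t y <= `|P r x - P t y| + `|Q r x - Q t y|.
  rewrite !gE.
  have -> : P r x * Q r x - P t y * Q t y =
    (P r x - P t y) * Q r x + P t y * (Q r x - Q t y) by ring.
  rewrite lerD//; apply: le_trans (ler_norm _) _; rewrite normrM.
    by rewrite ler_piMr// ger0_norm ?flat1_le1 ?flat1_ge0.
  by rewrite ler_piMl// ger0_norm ?flat1_le1 ?flat1_ge0.
have am : 2 * L0 * `|x - y| <= e + L0 ^+ 2 / e * (x - y) ^+ 2.
  rewrite -[(x - y) ^+ 2]real_normK ?num_real//; set a := `|x - y|.
  rewrite -subr_ge0 (_ : _ - _ = (e - L0 * a) ^+ 2 / e).
    by rewrite divr_ge0 ?sqr_ge0// ltW.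
  by field; rewrite gt_eqF.
move: d1 p1 q1 am.
set a := `|x - y|; set a2 := L0 ^+ 2 / e * _.
set p := `|P r x - P t y|; set p2 := `|Q r x - Q t y|.
lra.
Qed.

Lemma profile_mass_continuous t e : 0 <= t -> 0 < e -> exists2 d : R, 0 < d &
  forall r, 0 <= r -> `|r - t| <= d -> G r <= G t + e /\ G t <= G r + e.
Proof.
move=> t0 e0.
have q0 := mass_moment_ge0 (nu_mass t0).
(* The modulus and the motion of the barriers each cost [e1] per unit of mass, together at most
   [e / 2]; the transport cost takes the other half. *)
pose e1 := e / 2 / (2 * q + 1).
have e10 : 0 < e1 by rewrite !divr_gt0// ltr_wpDl// mulr_ge0.
have [L [M [L0 M0 HM]]] := profile_modulus e10.
have T0 : 0 < t + 1 by rewrite ltr_wpDl.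
have e20 : 0 < e / 2 / (L + 1) by rewrite !divr_gt0// ltr_wpDl.
have [d d0 Hd] := nu_close T0 e20.
pose d' := Num.min 1 (Num.min d (e1 / (M + 1))).
have d'0 : 0 < d' by rewrite !lt_min d0 ltr01/= divr_gt0// ltr_wpDl.
exists d' => // r r0 rt.
have rt1 : `|r - t| <= 1 by apply: le_trans rt _; rewrite ge_min lexx.
have rtd : `|r - t| <= d by apply: le_trans rt _; rewrite !ge_min lexx orbT.
have rtM : M * `|r - t| <= e1.
  apply: (@le_trans _ _ (M * (e1 / (M + 1)))).
    by rewrite ler_wpM2l// (le_trans rt)// !ge_min lexx !orbT.
  rewrite mulrA ler_pdivrMr ?ltr_wpDl// [e1 * _]mulrC.
  by rewrite ler_wpM2r ?lerDl// ltW.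
have rT : r <= t + 1 by move: rt1; rewrite ler_norml => /andP[_]; rewrite lerBlDl.
have tT : t <= t + 1 by rewrite lerDl.
have key u w : 0 <= u -> 0 <= w -> `|u - w| = `|r - t| ->
    transport_close (e / 2 / (L + 1)) (nu u) (nu w) -> G u <= G w + e.
  move=> u0 w0 uw cl.
  have ic : (nu w).-integrable setT (EFin \o (fun _ : measurableTypeR R => 2 * e1)).
    apply: (integrable_quadratic (A := `|2 * e1|) (B := 0) (nu_mass w0)).
      exact: cst_continuous.
    by move=> z; rewrite mul0r addr0.
  have iw := profile_integrable w w0.
  have := cl (g u) (fun y => g w y + 2 * e1) L (profile_integrable u u0)
    (integrableD measurableT iw ic) L0 _.
  move=> /(_ _)/le_trans; apply.
    move=> x y; apply: le_trans (HM u w x y) _; rewrite uw; move: rtM; set z := M * _.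
    lra.
  rewrite (RintegralD measurableT iw ic) (Rintegral_const _ (nu_mass w0)).
  rewrite -addrA lerD2l [leRHS](splitr e) lerD//.
    have -> : 2 * e1 * q = e / 2 * (2 * q) / (2 * q + 1) by rewrite /e1; ring.
    rewrite ler_pdivrMr ?ltr_wpDl ?mulr_ge0//.
    by apply: ler_wpM2l; [rewrite divr_ge0// ltW|rewrite lerDl].
  rewrite [L * _]mulrC mulrAC ler_pdivrMr ?ltr_wpDl//.
  by apply: ler_wpM2l; [rewrite divr_ge0// ltW|rewrite lerDl].
split; first by apply: key => //; exact: Hd.
by apply: key; rewrite 1?distrC//; apply: Hd => //; rewrite distrC.
Qed.

Lemma profile_mass_eq0 t :
  nu t `]beta s b b1 t, rho s c c1 t[%classic = 0%E -> G t = 0.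
Proof.
move=> nut0; apply/eqP; rewrite eq_le; apply/andP; split; last first.
  by apply: Rintegral_ge0 => x _; exact: barrier_profile_ge0.
rewrite /G /Rintegral.
have : (\int[nu t]_x (g t x)%:E <= 0)%E.
  apply: (@le_trans _ _
      (\int[nu t]_x (\1_`]beta s b b1 t, rho s c c1 t[ x)%:E)%E); last first.
    by rewrite integral_indic ?setIT ?nut0//; exact: measurable_itv.
  apply: le_integral_pointwise => x _; rewrite lee_fin indicE.
  have [|gx] := leP (g t x) 0; first by move=> /le_trans; apply.
  have := gx; rewrite barrier_profile_gt0 => bxc.
  by rewrite mem_set//= ?in_itv//; exact: barrier_profile_le1.
by move=> /fine_le0.
Qed.

(** A nonnegative profile with zero integral vanishes almost everywhere, yet it is positive on the
    whole interval, which would then be negligible. *)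
Lemma profile_mass_gt0 t : 0 <= t -> nu t `]beta s b b1 t, rho s c c1 t[%classic != 0%E ->
  0 < G t.
Proof.
move=> t0; apply: contra_neqT; rewrite -leNgt => G0.
have ig := profile_integrable t t0.
have I0 : (\int[nu t]_x `|(g t x)%:E| = 0)%E.
  under eq_integral do rewrite /= ger0_norm ?barrier_profile_ge0//.
  apply/eqP; rewrite eq_le integral_ge0 ?andbT; last first.
    by move=> x _; rewrite lee_fin barrier_profile_ge0.
  by rewrite -(fineK (integrable_fin_num measurableT ig)) lee_fin.
have mg : measurable_fun setT (EFin \o (g t : measurableTypeR R -> R)).
  exact: measurable_int ig.
have [/(_ I0) ae0 _] := ae_eq_integral_abs (nu t) measurableT mg.
have mI : measurable (`]beta s b b1 t, rho s c c1 t[%classic : set (measurableTypeR R)).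
  exact: measurable_itv.
apply: (measure_negligible mI).
apply: negligibleS ae0 => x /=; rewrite in_itv/= => bxc.
move=> /(_ Logic.I) [gx]; have : 0 < g t x by rewrite barrier_profile_gt0.
by rewrite gx ltxx.
Qed.

(** Outside []s, T[] the cutoff kills both sides. Inside, monotonicity of [v] carries the
    inequalities from the barriers to the points between them. *)
Lemma barrier_inner_le K r : 0 < K -> 0 < r ->
  (\int[nu r]_x ('D_(direction true) (seval (barrier_expr s T K b b1 c c1)) (r, x) +
     v r x * 'D_(direction false) (seval (barrier_expr s T K b b1 c c1)) (r, x))%:E <=
   (barrier_cutoff' s T K r * G r)%:E)%E.
Proof.
move=> K0 r0; have ig := profile_integrable r (ltW r0).
have ip : (nu r).-integrable setT
    (EFin \o (fun x : measurableTypeR R => barrier_cutoff' s T K r * g r x)).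
  exact: (integrableZl measurableT _ ig).
have -> : barrier_cutoff' s T K r * G r = \int[nu r]_x (barrier_cutoff' s T K r * g r x).
  by rewrite RintegralZl.
rewrite /Rintegral fineK ?integrable_fin_num//.
apply: le_integral_pointwise => x _; rewrite lee_fin !derive_seval.
have [rs|sr] := leP r s.
  have rs' : (r <= s + K^-1) || (T <= r).
    by rewrite (le_trans rs)// lerDl invr_ge0 ltW.
  rewrite seval_barrier_time_derivative seval_barrier_space_derivative.
  by rewrite !(barrier_cutoff_eq0 K0 rs').1 !(barrier_cutoff_eq0 K0 rs').2 !mul0r mulr0 !addr0.
have [Tr|rT] := leP T r.
  have rs' : (r <= s + K^-1) || (T <= r) by rewrite Tr orbT.
  rewrite seval_barrier_time_derivative seval_barrier_space_derivative.
  by rewrite !(barrier_cutoff_eq0 K0 rs').1 !(barrier_cutoff_eq0 K0 rs').2 !mul0r mulr0 !addr0.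
apply: barrier_transport_le => [bx|xc].
  apply: le_trans (beta_super sr rT); apply: v_decr; exact: ltW.
apply: le_trans (rho_sub sr rT) _; apply: v_decr; exact: ltW.
Qed.

(** By contradiction: mass present at [t] stays visible on [[t - k, t]], where the cutoff strictly
    decreases, whereas almost none is visible while the cutoff rises just after [s]. The time
    integral would then be negative instead of 0. *)
Lemma barrier t : s <= t -> t < T ->
  nu t `]beta s b b1 t, rho s c c1 t[%classic = 0%E.
Proof.
rewrite le_eqVlt => /predU1P[<-|st] tT.
  by rewrite /beta /rho !subrr !mulr0 !addr0.
apply/eqP; apply: contraT => nut.
have t0 : 0 <= t by exact: le_trans s_ge0 (ltW st).
have Gt := profile_mass_gt0 t0 nut.
have Gt2 : 0 < G t / 2 by rewrite divr_gt0.
have G0 r : 0 <= G r.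
  by apply: Rintegral_ge0 => x _; exact: barrier_profile_ge0.
have [d d0 Hd] := profile_mass_continuous t0 Gt2.
pose k := Num.min d ((t - s) / 2).
have k0 : 0 < k by rewrite lt_min d0 divr_gt0// subr_gt0.
have kts : k <= (t - s) / 2 by rewrite ge_min lexx orbT.
have kd : k <= d by rewrite ge_min lexx.
have stk : s < t - k by move: kts st; lra.
have [C C0 HC] := @step_up'_bounded R.
set H1 := flat (1 : {poly R}) (flat 1 1).
have H10 : 0 < H1 by apply: flat1_gt0; exact: flat1_gt0.
have Tt : 0 < T - t by rewrite subr_gt0.
(* Lower bound on [[t - k, t]] for the decay rate of the factor in [T - r]; [H1] is the plateau
   value of the step. *)
pose m0 := (T - s) ^- 2 * flat (1 : {poly R}) (T - t).
have Ts : 0 < T - s by rewrite subr_gt0 (lt_trans st).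
have m00 : 0 < m0 by rewrite mulr_gt0 ?flat1_gt0// invr_gt0 exprn_gt0.
pose B := H1 * m0 * (G t / 2).
have B0 : 0 < B by apply: mulr_gt0 => //; exact: mulr_gt0.
pose e := B * k / (4 * (C + 1)).
have C1 : 0 < 4 * (C + 1) by rewrite mulr_gt0// ltr_wpDl.
have e0 : 0 < e by rewrite divr_gt0// mulr_gt0.
have [d2 d20 Hd2] := profile_mass_continuous s_ge0 e0.
have Gs : G s = 0.
  by apply: profile_mass_eq0; rewrite /beta /rho !subrr !mulr0 !addr0.
pose w := Num.min d2 ((t - k - s) / 2).
have w0 : 0 < w by rewrite lt_min d20 divr_gt0// subr_gt0.
have wd2 : w <= d2 by rewrite ge_min lexx.
have wts : w <= (t - k - s) / 2 by rewrite ge_min lexx orbT.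
(* With this steepness the step reaches its plateau exactly at [s + w]. *)
pose K := 2 / w.
have K0 : 0 < K by rewrite divr_gt0.
have Kce0 : 0 <= K * C * e.
  by apply: mulr_ge0; [apply: mulr_ge0 => //|]; exact: ltW.
have Kw : K * w = 2 by rewrite /K divfK// gt_eqF.
have Kw2 : K^-1 = w / 2 by rewrite /K invf_div.
have := @nu_continuity _ (test_function_barrier T b b1 c c1 s_ge0 K0).
(* As [K * w = 2], the bound equals [2 C e - B k], which the choice of [e] makes negative. *)
move=> I0; suff : (0 <= (K * C * e * w - B * (t - (t - k)))%:E)%E.
  rewrite lee_fin (_ : t - (t - k) = k); last by ring.
  have -> : K * C * e * w = 2 * C * e by rewrite -Kw; ring.
  rewrite subr_ge0 leNgt => /negP[].
  rewrite /e mulrA ltr_pdivrMr//.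
  rewrite [B * k]lock; have : 0 < B * k by rewrite mulr_gt0.
  rewrite {1}[B * k]lock; set z := locked _ => z0.
  by have := mulr_ge0 C0 (ltW z0); lra.
rewrite -I0.
apply: (integral_le_steps (s := s)); [exact: ltW| |exact: le_lt_trans stk| |].
- exact: Kce0.
- by rewrite gerBl ltW.
move=> r r0; apply: le_trans (barrier_inner_le K0 r0) _; rewrite lee_fin.
rewrite !indicE !mem_setE !in_itv/=.
have [rs|rs] := boolP ((r <= s + K^-1) || (T <= r)).
  rewrite (barrier_cutoff_eq0 K0 rs).2 mul0r.
  have -> : (t - k <= r) && (r <= t) = false.
    apply/negbTE/negP => /andP[tr rt]; move: rs => /orP[|]; last first.
      by rewrite leNgt (le_lt_trans rt tT).
    by rewrite Kw2 leNgt => /negP[]; move: wts stk tr w0; lra.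
  by rewrite mulr0 subr0 mulr_ge0.
move: rs; rewrite negb_or -!ltNge => /andP[sr rT].
have sr' : s <= r by rewrite (le_trans _ (ltW sr))// lerDl invr_ge0 ltW.
have Tr0 : 0 < T - r by rewrite subr_gt0.
have [rw|wr] := leP r (s + w).
  have -> : (t - k <= r) && (r <= t) = false.
    by apply/negbTE/negP => /andP[tr rt]; move: rw wts tr stk; lra.
  rewrite sr'/= mulr1 mulr0 subr0.
  apply: (@le_trans _ _ (K * C * G r)); last first.
    apply: ler_wpM2l; first by apply: mulr_ge0 => //; exact: ltW.
    have [] := Hd2 r (ltW r0) _; last by rewrite Gs add0r.
    by rewrite ger0_norm ?subr_ge0// (le_trans _ wd2)// lerBlDl.
  apply: ler_wpM2r => //.
  rewrite /barrier_cutoff' lerBlDr; apply: (@le_trans _ _ (K * C)); last first.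
    by rewrite lerDl mulr_ge0 ?step_up_ge0 ?flat1_deriv_ge0.
  have /andP[s1 s2] := HC (K * (r - s) - 1).
  rewrite -[leRHS]mulr1; apply: ler_pM; rewrite ?flat1_ge0 ?flat1_le1//.
    by apply: mulr_ge0 => //; exact: ltW.
  by apply: ler_wpM2l => //; exact: ltW.
(* Past [s + w] the step is constant, and only the decreasing factor contributes to the
   derivative. *)
have Kr : 1 <= K * (r - s) - 1.
  rewrite lerBrDr (_ : 1 + 1 = K * w); last by rewrite Kw.
  by rewrite ler_pM2l//; move: wr; lra.
rewrite andbF /barrier_cutoff' !(step_up_ge1 Kr).1 !(step_up_ge1 Kr).2.
rewrite !mulr0 mul0r !sub0r mulNr lerN2.
have [/andP[tr rt]|_] := boolP (t - k <= r <= t); last first.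
  by rewrite mulr0 !mulr_ge0 ?flat1_deriv_ge0 ?flat1_ge0.
rewrite mulr1 /B; apply: ler_pM.
- by apply: mulr_ge0; exact: ltW.
- exact: ltW.
- rewrite ler_wpM2l ?flat1_ge0// flat1_derivE// /m0.
  apply: ler_pM; rewrite ?invr_ge0 ?sqr_ge0 ?flat1_ge0//.
    rewrite lef_pV2 ?posrE ?exprn_gt0// ler_sqr ?nnegrE ?(ltW Tr0) ?(ltW Ts)//.
    by rewrite lerD2l lerN2.
  by rewrite flat1_mono// lerD2l lerN2.
- have [|_] := Hd r (ltW r0) _; last by rewrite -[X in X <= _]/(G t); lra.
  by rewrite ler_norml; apply/andP; split; move: kd tr rt; lra.
Qed.


End Barrier.
End ContinuityEquation.

(** * Support *)

Section Support.
Context {R : realType}.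
Implicit Types (nu : borel_measure R) (U : set R).

Lemma msupp_rational_cover nu x : ~ msupp nu x ->
  exists ab : rat * rat, ratr ab.1 < x < ratr ab.2 /\
    nu `]ratr ab.1, ratr ab.2[%classic = 0%E.
Proof.
move=> /existsNP[V /not_implyP[oV /not_implyP[Vx /negP]]].
rewrite -leNgt => nuV.
have /nbhs_ballP[e /= e0 eV] : nbhs x V by exact: open_nbhs_nbhs.
have [a] : exists a, ratr a \in `](x - e), x[ by apply: rat_in_itvoo; rewrite gtrBl.
have [b] : exists b, ratr b \in `]x, (x + e)[ by apply: rat_in_itvoo; rewrite ltrDl.
rewrite !in_itv/= => /andP[xb be] /andP[ea ax]; exists (a, b) => /=.
split; first by rewrite ax.
apply/eqP; rewrite eq_le measure_ge0 andbT; apply: le_trans nuV.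
apply: le_measure; rewrite ?inE; [exact: measurable_itv|exact: open_measurable|].
move=> y /=; rewrite in_itv/= => /andP[ay yb]; apply: eV.
rewrite -ball_normE /= ltr_norml; apply/andP; split; lra.
Qed.

(** Lindelof argument: null intervals with rational endpoints cover [U], and they are countably
    many, enumerated by [pickle]. *)
Lemma disjoint_msupp_null nu U : open U -> (forall x, U x -> ~ msupp nu x) ->
  nu U = 0%E.
Proof.
move=> oU Unu.
pose F k : set (measurableTypeR R) :=
  if unpickle k is Some (a, b) then
    (if nu `]ratr a, ratr b[%classic == 0%E then `]ratr a, ratr b[%classic else set0)
  else set0.
have F0 k : nu.-negligible (F k).
  rewrite /F; case: unpickle => [[a b]|]; last exact: negligible_set0.
  case: eqP => [nu0|_]; last exact: negligible_set0.
  by apply/negligibleP => //; exact: measurable_itv.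
have mU : measurable (U : set (measurableTypeR R)) by exact: open_measurable.
apply: (measure_negligible mU); apply: negligibleS (negligible_bigcup F0).
move=> x /Unu/msupp_rational_cover[[a b] /= [axb nu0]].
exists (pickle (a, b)); first exact: Logic.I.
rewrite /F pickleK nu0 eqxx.
by have : x \in `]ratr a, ratr b[ by rewrite in_itv.
Qed.

Lemma msupp_open_meets nu U : open U -> nu U != 0%E -> exists2 x, U x & msupp nu x.
Proof.
move=> oU; apply: contra_neqP => H; apply: disjoint_msupp_null => // x Ux sx.
by apply: H; exists x.
Qed.

Lemma msupp_nonempty nu : nu setT != 0%E -> exists x, msupp nu x.
Proof. by move=> /(msupp_open_meets openT)[x _ ?]; exists x. Qed.

Lemma msupp_itv_neq0 nu x a b : msupp nu x -> a < x -> x < b ->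
  nu `]a, b[%classic != 0%E.
Proof.
move=> sx ax xb; rewrite gt_eqF//; apply: sx; first exact: interval_open.
by rewrite /= in_itv/= ax.
Qed.

End Support.

(** Consider the infimum of the counterexamples: closure from the left gives [P] there, and the
    forward step pushes the counterexamples strictly beyond it. *)
Lemma real_induction (R : realType) (P : R -> Prop) :
  P 0 ->
  (forall t, 0 <= t -> P t ->
    exists2 d : R, 0 < d & forall r, t <= r -> r <= t + d -> P r) ->
  (forall t, 0 < t -> (forall s, 0 <= s -> s < t -> P s) -> P t) ->
  forall t, 0 <= t -> P t.
Proof.
move=> P0 Pr Pl t t0; apply: contrapT => nPt.
pose B := [set r | 0 <= r /\ ~ P r].
have hB : has_inf B by split; [exists t|exists 0 => r []].
have B0 : 0 <= inf B by apply: lb_le_inf; [exact: hB.1|move=> r []].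
have below s : 0 <= s -> s < inf B -> P s.
  move=> s0 sB; apply: contrapT => nPs.
  by have := ge_inf hB.2 (conj s0 nPs); rewrite leNgt sB.
have PB : P (inf B).
  move: B0; rewrite le_eqVlt => /predU1P[<-//|B0].
  by apply: Pl => // s; exact: below.
have [d d0 Hd] := Pr _ B0 PB.
have : inf B + d <= inf B.
  apply: lb_le_inf; first exact: hB.1.
  move=> r [r0 nPr]; rewrite leNgt; apply/negP => rd; apply: nPr.
  have [rB|Br] := ltP r (inf B); first exact: below.
  by apply: Hd => //; exact: ltW.
by rewrite gerDl leNgt d0.
Qed.

(** * Exponential contraction of the support *)

Section SupportContraction.
Context {R : realType}.
Variables (nu : R -> borel_measure R) (q : R) (v : R -> R -> R) (lam : R).
Hypothesis q_gt0 : 0 < q.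
Hypothesis lam_gt0 : 0 < lam.
Hypothesis nu_mass : forall t : R, 0 <= t -> mass_moment q (nu t).
Hypothesis nu_close : forall T e : R, 0 < T -> 0 < e -> exists2 d : R, 0 < d &
  forall s t : R, 0 <= s -> s <= T -> 0 <= t -> t <= T -> `|s - t| <= d ->
  transport_close e (nu s) (nu t).
Hypothesis nu_continuity : forall f, test_function f ->
  (\int[lebesgue_measure]_(t in `]0%R, +oo[) \int[nu t]_x
     ('D_(direction true) f (t, x) + v t x * 'D_(direction false) f (t, x))%:E
   = 0)%E.
Hypothesis v_contr : forall t x y : R, 0 <= t -> y <= x ->
  v t x - v t y <= - lam * (x - y).
Hypothesis v_cont : forall t x e : R, 0 <= t -> 0 < e -> exists2 d : R, 0 < d &
  forall s y, 0 <= s -> `|s - t| <= d -> `|y - x| <= d -> `|v s y - v t x| <= e.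
Hypothesis v_growth : forall t : R, 0 <= t -> exists C d : R, 0 < d /\
  forall s x, 0 <= s -> `|s - t| <= d -> `|v s x| <= C * (1 + `|x|).

Lemma v_decreasing t x y : 0 <= t -> y <= x -> v t x <= v t y.
Proof.
move=> t0 yx; rewrite -subr_le0; apply: le_trans (v_contr t0 yx) _.
by rewrite mulNr oppr_le0 mulr_ge0 ?subr_ge0// ltW.
Qed.

Let barrier_v := barrier nu_mass nu_close nu_continuity v_decreasing.

(** A stationary profile on []x - e, x + e[] sees positive mass at time [t], hence at nearby times
    by continuity. *)
Lemma msupp_lower_semicontinuous t x e : 0 <= t -> msupp (nu t) x -> 0 < e ->
  exists2 d : R, 0 < d & forall r, 0 <= r -> `|r - t| <= d ->
    exists2 y, msupp (nu r) y & `|y - x| < e.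
Proof.
move=> t0 sx e0.
have betaE r : beta 0 (x - e) 0 r = x - e by rewrite /beta mul0r addr0.
have rhoE r : rho 0 (x + e) 0 r = x + e by rewrite /rho mul0r addr0.
have nz : nu t `]beta 0 (x - e) 0 t, rho 0 (x + e) 0 t[%classic != 0%E.
  by rewrite betaE rhoE; apply: (msupp_itv_neq0 sx); [rewrite gtrBl|rewrite ltrDl].
have Gt := profile_mass_gt0 nu_mass t0 nz.
have Gt2 := divr_gt0 Gt (ltr0Sn R 1).
have [d d0 Hd] := profile_mass_continuous nu_mass nu_close 0 (x - e) 0 (x + e) 0 t0 Gt2.
exists d => // r r0 rt.
have : nu r `](x - e), (x + e)[%classic != 0%E.
  apply/eqP => nur0.
  have G0 := @profile_mass_eq0 _ nu 0 (x - e) 0 (x + e) 0 r.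
  rewrite betaE rhoE in G0; have {}G0 := G0 nur0.
  have [_] := Hd r r0 rt; move: Gt; rewrite G0; lra.
move=> /(msupp_open_meets (@interval_open _ _ _ _ _))[].
  by [].
  by [].
move=> y; rewrite /= in_itv/= => /andP[h1 h2] sy; exists y => //.
by rewrite ltr_distl h1 h2.
Qed.

Lemma v_growth_gt0 t : 0 <= t -> exists C d : R, [/\ 0 < C, 0 < d &
  forall s x, 0 <= s -> `|s - t| <= d -> `|v s x| <= C * (1 + `|x|)].
Proof.
move=> t0; have [C [d [d0 HC]]] := v_growth t0.
exists (Num.max C 1), d; split; rewrite // ?lt_max ?ltr01 ?orbT//.
move=> s x s0 st; apply: le_trans (HC _ _ s0 st) _.
by rewrite ler_wpM2r ?addr_ge0// le_max lexx.
Qed.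

(** Controls the auxiliary far barrier. Remaining in [[0, N]], it meets speeds of at most
    [C (1 + N)], its own; and on a time interval independent of [N] it stays beyond [(N - 1) / 2],
    which is arbitrarily far. *)
Lemma retreat_bounds (C N t s : R) : 0 <= C -> 1 <= N -> t <= s -> s <= t + 2^-1 / C ->
  (N - 1) / 2 <= rho t N (- (C * (1 + N))) s <= N.
Proof.
move=> C0 N1 ts sC.
have s1 : C * (s - t) <= 2^-1.
  move: C0; rewrite le_eqVlt => /predU1P[<-|C0]; first by rewrite mul0r.
  by rewrite mulrC -ler_pdivlMr// lerBlDl.
have s2 : 0 <= C * (s - t) by rewrite mulr_ge0 ?subr_ge0.
rewrite /rho.
have -> : N + - (C * (1 + N)) * (s - t) = N - (C * (s - t)) * (1 + N) by ring.
have N2 : 0 <= 1 + N by lra.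
have := ler_wpM2r N2 s1; have := mulr_ge0 s2 N2.
by set z := C * (s - t) * (1 + N); move=> z0 z1; apply/andP; split; lra.
Qed.

Lemma upper_barrier t b b1 d : 0 <= t -> 0 < d ->
  (forall x, msupp (nu t) x -> x <= b) ->
  (forall r, t < r -> r < t + d -> v r (beta t b b1 r) <= b1) ->
  exists2 d' : R, 0 < d' & forall r, t <= r -> r < t + d' -> forall x,
    msupp (nu r) x -> x <= beta t b b1 r.
Proof.
move=> t0 d0 tb vb.
have [C [dg [C1 dg0 HC]]] := v_growth_gt0 t0.
pose d' := Num.min d (Num.min dg (2^-1 / C)).
have d'0 : 0 < d' by rewrite !lt_min d0 dg0/= divr_gt0.
exists d' => // r tr rd x sx; rewrite leNgt; apply/negP => bx.
(* Makes [(N - 1) / 2] exceed [|x|], so that [x] lies between the two barriers; [d'] does not depend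
   on [x]. *)
pose N := Num.max 1 (2 * `|x| + 2).
have N1 : 1 <= N by rewrite le_max lexx.
have Nx : 2 * `|x| + 2 <= N by rewrite le_max lexx orbT.
have shrink s : t <= s -> s < t + d' ->
    (N - 1) / 2 <= rho t N (- (C * (1 + N))) s <= N.
  move=> ts sd; apply: retreat_bounds; rewrite ?(ltW C1)//.
  by rewrite (le_trans (ltW sd))// lerD2l !ge_min lexx !orbT.
have nut : nu t `]b, N[%classic = 0%E.
  apply: disjoint_msupp_null; first exact: interval_open.
  move=> y; rewrite /= in_itv/= => /andP[b_y _] /tb; lra.
have := @barrier_v t (t + d') b b1 N (- (C * (1 + N))) t0.
move=> /(_ _ _ nut r tr rd) H.
have : nu r `]beta t b b1 r, rho t N (- (C * (1 + N))) r[%classic = 0%E.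
  apply: H => s ts sd.
    by apply: vb => //; apply: lt_le_trans sd _; rewrite lerD2l ge_min lexx.
  have s0 : 0 <= s by apply: le_trans t0 (ltW ts).
  have std : `|s - t| <= dg.
    rewrite ger0_norm ?subr_ge0 ?(ltW ts)// lerBlDl (le_trans (ltW sd))// lerD2l.
    by rewrite !ge_min lexx orbT.
  rewrite lerNl; apply: (@le_trans _ _ (`|v s (rho t N (- (C * (1 + N))) s)|)).
    by rewrite -normrN ler_norm.
  apply: le_trans (HC _ _ s0 std) _; rewrite ler_wpM2l ?(ltW C1)// lerD2l.
  have /andP[h1 h2] := shrink _ (ltW ts) sd.
  by rewrite ger0_norm// (le_trans _ h1)// divr_ge0// subr_ge0.
apply/eqP; apply: (msupp_itv_neq0 sx bx).
have /andP[h1 _] := shrink _ tr rd.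
apply: lt_le_trans h1; have := ler_norm x; move: Nx; lra.
Qed.

(** Mirror image of [upper_barrier], with the auxiliary barrier starting at [- N]. *)
Lemma lower_barrier t c c1 d : 0 <= t -> 0 < d ->
  (forall x, msupp (nu t) x -> c <= x) ->
  (forall r, t < r -> r < t + d -> c1 <= v r (rho t c c1 r)) ->
  exists2 d' : R, 0 < d' & forall r, t <= r -> r < t + d' -> forall x,
    msupp (nu r) x -> rho t c c1 r <= x.
Proof.
move=> t0 d0 tc vc.
have [C [dg [C1 dg0 HC]]] := v_growth_gt0 t0.
pose d' := Num.min d (Num.min dg (2^-1 / C)).
have d'0 : 0 < d' by rewrite !lt_min d0 dg0/= divr_gt0.
exists d' => // r tr rd x sx; rewrite leNgt; apply/negP => xc.
pose N := Num.max 1 (2 * `|x| + 2).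
have N1 : 1 <= N by rewrite le_max lexx.
have Nx : 2 * `|x| + 2 <= N by rewrite le_max lexx orbT.
have shrink s : t <= s -> s < t + d' ->
    - N <= beta t (- N) (C * (1 + N)) s <= - ((N - 1) / 2).
  move=> ts sd; rewrite lerNr (_ : beta _ _ _ _ = - rho t N (- (C * (1 + N))) s).
    rewrite opprK lerN2 andbC; apply: retreat_bounds; rewrite ?(ltW C1)//.
    by rewrite (le_trans (ltW sd))// lerD2l !ge_min lexx !orbT.
  by rewrite /beta /rho; ring.
have nut : nu t `](- N), c[%classic = 0%E.
  apply: disjoint_msupp_null; first exact: interval_open.
  move=> y; rewrite /= in_itv/= => /andP[_ yc] /tc; lra.
have := @barrier_v t (t + d') (- N) (C * (1 + N)) c c1 t0.
move=> /(_ _ _ nut r tr rd) H.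
have : nu r `]beta t (- N) (C * (1 + N)) r, rho t c c1 r[%classic = 0%E.
  apply: H => s ts sd; last first.
    by apply: vc => //; apply: lt_le_trans sd _; rewrite lerD2l ge_min lexx.
  have s0 : 0 <= s by apply: le_trans t0 (ltW ts).
  have std : `|s - t| <= dg.
    rewrite ger0_norm ?subr_ge0 ?(ltW ts)// lerBlDl (le_trans (ltW sd))// lerD2l.
    by rewrite !ge_min lexx orbT.
  apply: le_trans (ler_norm _) _.
  apply: le_trans (HC _ _ s0 std) _; rewrite ler_wpM2l ?(ltW C1)// lerD2l.
  have /andP[h1 h2] := shrink _ (ltW ts) sd.
  rewrite ler0_norm; first by rewrite lerNl.
  by rewrite (le_trans h2)// oppr_le0 divr_ge0// subr_ge0.
apply/eqP; apply: (fun h => msupp_itv_neq0 sx h xc).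
have /andP[_ h1] := shrink _ tr rd.
apply: le_lt_trans h1 _; have := ler_norm (- x); rewrite normrN; move: Nx; lra.
Qed.

Section Decay.
Variables (D e : R).
Hypothesis D_ge0 : 0 <= D.
Hypothesis e_gt0 : 0 < e.

Let bound t := expR (- (lam * t)) * D + 2 * e * t.
Let small t := forall x y, msupp (nu t) x -> msupp (nu t) y -> x - y <= bound t.

Lemma small_step t : 0 <= t -> small t ->
  exists2 d : R, 0 < d & forall r, t <= r -> r <= t + d -> small r.
Proof.
move=> t0 St.
have q0 : nu t setT != 0%E by rewrite (nu_mass t0).1 gt_eqF.
have [z sz] := msupp_nonempty q0.
pose A := [set x | msupp (nu t) x].
have hS : has_sup A.
  split; first by exists z.
  by exists (z + bound t) => x sx; rewrite -lerBlDl; exact: St.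
have hI : has_inf A.
  split; first by exists z.
  by exists (z - bound t) => x sx; rewrite lerBlDl -lerBlDr; exact: St.
pose b := sup A; pose a := inf A.
have tb x : msupp (nu t) x -> x <= b by move=> sx; exact: (ub_le_sup hS.2).
have ta x : msupp (nu t) x -> a <= x by move=> sx; exact: (ge_inf hI.2).
have ab : a <= b by exact: le_trans (ta _ sz) (tb _ sz).
have baD : b - a <= bound t.
  rewrite lerBlDr; apply: ge_sup; first exact: hS.1.
  move=> x sx; rewrite -lerBlDl; apply: lb_le_inf; first exact: hI.1.
  by move=> y sy; rewrite lerBlDl -lerBlDr; exact: St.
have [db db0 Hb] := v_cont b t0 e_gt0.
have [da da0 Ha] := v_cont a t0 e_gt0.
pose b1 := v t b + e; pose a1 := v t a - e.
(* During time [d] each barrier moves by no more than the radius on which [v] varies by at most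
   [e]. *)
pose d := Num.min (Num.min db (db / (`|b1| + 1))) (Num.min da (da / (`|a1| + 1))).
have b10 : 0 < `|b1| + 1 by rewrite ltr_wpDl.
have a10 : 0 < `|a1| + 1 by rewrite ltr_wpDl.
have d0 : 0 < d by rewrite !lt_min db0 da0 !divr_gt0.
have slope u (du : R) s : 0 < du -> d <= du / (`|u| + 1) -> t < s -> s < t + d ->
    `|u * (s - t)| <= du.
  move=> du0 ddu ts sd; have u0 : 0 < `|u| + 1 by rewrite ltr_wpDl.
  rewrite normrM (@ger0_norm _ (s - t)) ?subr_ge0 ?(ltW ts)//.
  apply: (@le_trans _ _ ((`|u| + 1) * (s - t))).
    by rewrite ler_wpM2r ?lerDl// subr_ge0 ltW.
  rewrite mulrC -ler_pdivlMr// (le_trans _ ddu)// lerBlDl ltW//.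
have vb s : t < s -> s < t + d -> v s (beta t b b1 s) <= b1.
  move=> ts sd; have s0 := le_trans t0 (ltW ts).
  have := Hb s (beta t b b1 s) s0 _ _; rewrite /beta addrAC subrr add0r => H.
  have {}H : `|v s (b + b1 * (s - t)) - v t b| <= e.
    apply: H; last by apply: slope ts sd; rewrite // !ge_min lexx orbT.
    rewrite ger0_norm ?subr_ge0 ?(ltW ts)// lerBlDl (le_trans (ltW sd))// lerD2l.
    by rewrite !ge_min lexx.
  by move: H; rewrite ler_norml /b1 => /andP[_]; rewrite lerBlDl.
have va s : t < s -> s < t + d -> a1 <= v s (rho t a a1 s).
  move=> ts sd; have s0 := le_trans t0 (ltW ts).
  have := Ha s (rho t a a1 s) s0 _ _; rewrite /rho addrAC subrr add0r => H.
  have {}H : `|v s (a + a1 * (s - t)) - v t a| <= e.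
    apply: H; last by apply: slope ts sd; rewrite // !ge_min lexx !orbT.
    rewrite ger0_norm ?subr_ge0 ?(ltW ts)// lerBlDl (le_trans (ltW sd))// lerD2l.
    by rewrite !ge_min lexx !orbT.
  by move: H; rewrite ler_norml /a1 => /andP[+ _]; rewrite lerBrDl.
have [d1 d10 Hd1] := upper_barrier t0 d0 tb vb.
have [d2 d20 Hd2] := lower_barrier t0 d0 ta va.
(* Halving passes from the half-open time intervals of the barriers to a closed one. *)
pose d3 := Num.min d1 d2 / 2.
have m0 : 0 < Num.min d1 d2 by rewrite lt_min d10.
have d30 : 0 < d3 by rewrite divr_gt0.
have d3m : d3 < Num.min d1 d2 by rewrite /d3; move: m0; set mm := Num.min _ _; lra.
exists d3 => // r tr rd x y sx sy.
have r1 : r < t + d1.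
  by rewrite (le_lt_trans rd)// ltrD2l (lt_le_trans d3m)// ge_min lexx.
have r2 : r < t + d2.
  by rewrite (le_lt_trans rd)// ltrD2l (lt_le_trans d3m)// ge_min lexx orbT.
have xb := Hd1 r tr r1 x sx; have ya := Hd2 r tr r2 y sy.
pose tau := r - t; have tau0 : 0 <= tau by rewrite subr_ge0.
apply: (@le_trans _ _ ((b - a) + tau * (v t b - v t a) + 2 * e * tau)).
  by move: xb ya; rewrite /beta /rho /b1 /a1 -/tau; lra.
(* Contractivity of [v] gives the factor [1 - lam * tau], which is at most [exp(- lam * tau)]. *)
have h1 : (b - a) + tau * (v t b - v t a) <= (b - a) * expR (- (lam * tau)).
  apply: (@le_trans _ _ ((b - a) * (1 + - (lam * tau)))).
    have := ler_wpM2l tau0 (v_contr t0 ab); lra.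
  by rewrite ler_wpM2l ?subr_ge0// expR_ge1Dx.
have h2 : (b - a) * expR (- (lam * tau)) <= bound t * expR (- (lam * tau)).
  by rewrite ler_wpM2r// expR_ge0.
have h3 : bound t * expR (- (lam * tau)) <= expR (- (lam * r)) * D + 2 * e * t.
  rewrite /bound mulrDl lerD//.
    rewrite mulrAC -expRD (_ : - (lam * t) - lam * tau = - (lam * r))//.
    by rewrite /tau; ring.
  rewrite ler_piMr// ?mulr_ge0//; first exact: ltW.
  by rewrite expR_le1 oppr_le0 mulr_ge0// ltW.
rewrite /bound (_ : 2 * e * r = 2 * e * t + 2 * e * tau); last by rewrite /tau; ring.
move: h1 h2 h3; lra.
Qed.

(** Approximate both support points by support points at an earlier time [s]: each end costs
    [eta / 3], and so does the continuity of the exponential term, while the other term of the bound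
    increases in time. *)
Lemma small_left_closed t : 0 < t -> (forall s, 0 <= s -> s < t -> small s) -> small t.
Proof.
move=> t0 H x y sx sy; apply/ler_addgt0Pr => eta eta0.
have eta3 : 0 < eta / 3 by rewrite divr_gt0.
have [d1 d10 Hd1] := msupp_lower_semicontinuous (ltW t0) sx eta3.
have [d2 d20 Hd2] := msupp_lower_semicontinuous (ltW t0) sy eta3.
have cb : (expR (- (lam * s)) * D) @[s --> t] --> expR (- (lam * t)) * D.
  apply: cvgMl; apply: (@cvg_comp _ _ _ (fun s => - (lam * s)) expR).
    by apply: cvgN; apply: cvgMr; exact: cvg_id.
  exact: continuous_expR.
have near_b : \forall s \near t^'-, `|expR (- (lam * t)) * D - expR (- (lam * s)) * D| <= eta / 3.
  have /cvgrPdist_le := cvg_at_left_filter cb; exact.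
near t^'- => s.
have st : s < t by [].
have s0 : 0 <= s by near: s; exact: nbhs_left_ge.
have sd1 : `|s - t| <= d1.
  rewrite distrC ger0_norm ?subr_ge0 ?(ltW st)// lerBlDr -lerBlDl.
  by near: s; apply: nbhs_left_ge; rewrite gtrBl.
have sd2 : `|s - t| <= d2.
  rewrite distrC ger0_norm ?subr_ge0 ?(ltW st)// lerBlDr -lerBlDl.
  by near: s; apply: nbhs_left_ge; rewrite gtrBl.
have [x' sx' xx'] := Hd1 s s0 sd1.
have [y' sy' yy'] := Hd2 s s0 sd2.
have Hs := H s s0 st x' y' sx' sy'.
have nb : `|expR (- (lam * t)) * D - expR (- (lam * s)) * D| <= eta / 3 by near: s.
have es : 2 * e * s <= 2 * e * t by rewrite ler_wpM2l ?mulr_ge0// ltW.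
move: nb xx' yy' Hs es; rewrite ler_norml !ltr_norml /bound.
move=> /andP[n1 n2] /andP[x1 x2] /andP[y1 y2]; lra.
Unshelve. all: by end_near.
Qed.

End Decay.

Lemma msupp_contraction D : 0 <= D ->
  (forall x y, msupp (nu 0) x -> msupp (nu 0) y -> x - y <= D) ->
  forall t x y, 0 <= t -> msupp (nu t) x -> msupp (nu t) y ->
  x - y <= expR (- (lam * t)) * D.
Proof.
move=> D0 H0 t x y t0 sx sy; apply/ler_addgt0Pr => eta eta0.
(* Chosen so that the accumulated error [2 * e * t] is at most [eta]. *)
pose e := eta / (2 * (t + 1)).
have t1 : 0 < t + 1 by rewrite ltr_wpDl.
have t2 : 0 < 2 * (t + 1) by rewrite mulr_gt0.
have e0 : 0 < e by rewrite divr_gt0.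
have start x' y' : msupp (nu 0) x' -> msupp (nu 0) y' ->
    x' - y' <= expR (- (lam * 0)) * D + 2 * e * 0.
  by rewrite !mulr0 oppr0 expR0 mul1r addr0; exact: H0.
have Pt : forall t, 0 <= t -> forall x y, msupp (nu t) x -> msupp (nu t) y ->
    x - y <= expR (- (lam * t)) * D + 2 * e * t.
  apply: real_induction; first exact: start.
    by move=> s; exact: small_step.
  by move=> s; exact: small_left_closed.
apply: le_trans (Pt _ t0 _ _ sx sy) _; rewrite lerD2l.
have -> : 2 * e * t = eta * t / (t + 1) by rewrite /e; field; rewrite gt_eqF.
by rewrite ler_pdivrMr// ler_pM2l// lerDl.
Qed.

End SupportContraction.

(** * Extended diameter and conclusion *)

Section Diameter.
Context {R : realType}.

Lemma eq_measure_msupp (mu nu : borel_measure R) :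
  Defs.eq_measure mu nu -> msupp mu = msupp nu.
Proof.
move=> mn; apply/seteqP; split => x sx U oU Ux; have := sx U oU Ux;
  by rewrite mn//; exact: open_measurable.
Qed.

(** Compactness excludes the value [+oo] and a point of the set excludes [-oo], so the extended
    diameter can be handled as a real number. *)
Lemma diam_bounded (A : set R) : compact A -> A !=set0 ->
  exists2 D : R, 0 <= D & diam A = D%:E /\ forall x y, A x -> A y -> x - y <= D.
Proof.
move=> /compact_bounded[M [_ /(_ (M + 1))]]; rewrite ltrDl => /(_ ltr01) AM [z Az].
pose S := [set (`|z.1 - z.2|)%:E | z in A `*` A].
have up : (diam A <= (2 * (M + 1))%:E)%E.
  apply: ge_ereal_sup => _ [[x y] [/= Ax Ay] <-]; rewrite lee_fin.
  have := ler_normB x y; have := AM _ Ax; have := AM _ Ay => /=; lra.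
have lo x y : A x -> A y -> ((`|x - y|)%:E <= diam A)%E.
  by move=> Ax Ay; apply: ereal_sup_ubound; exists (x, y).
have lo0 : (0 <= diam A)%E by have := lo z z Az Az; rewrite subrr normr0.
have fin : diam A \is a fin_num.
  by rewrite ge0_fin_numE//; apply: le_lt_trans up _; exact: ltry.
exists (fine (diam A)); first exact: fine_ge0.
split; first by rewrite fineK.
move=> x y Ax Ay; rewrite -lee_fin fineK//; apply: le_trans (lo _ _ Ax Ay).
by rewrite lee_fin ler_norm.
Qed.

Lemma diam_le (A : set R) (D : R) :
  (forall x y, A x -> A y -> x - y <= D) -> (diam A <= D%:E)%E.
Proof.
move=> AD; apply: ge_ereal_sup => _ [[x y] [/= Ax Ay] <-].
by rewrite lee_fin ler_norml AD// andbT lerNl opprB AD.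
Qed.

End Diameter.

Theorem proposition3p8 (R : realType) (n : nat) (m p : 'I_n -> R) (E : R)
    (m_gt0 : forall j, 0 < m j) (p_gt0 : forall j, 0 < p j)
    (W : R -> 'M[R]_n) (kappa : 'M[R]_n)
    (W_adm : admissible_potential W kappa)
    (mu0 : 'I_n -> borel_measure R) (mu0P : state_space m p E mu0)
    (mu : R -> 'I_n -> borel_measure R)
    (mu_flow : gradient_flow_solution m p E W mu0 mu)
    (i : 'I_n) (supp_compact : compact (msupp (mu0 i)))
    (S_gt0 : 0 < \sum_j kappa i j * p j) :
  forall t : R, 0 <= t ->
    (diam (msupp (mu t i)) <=
     (expR (- (m i * (\sum_j kappa i j * p j) * t)))%:E
     * diam (msupp (mu0 i)))%E.
Proof.
move=> t t0.
have [AC mu_start mu_distr] := mu_flow.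
have muP s : 0 <= s -> state_space m p E (mu s) by exact: AC.1.
have mu_mass j s (s0 : 0 <= s) : mass_moment (p j) (mu s j).
  exact: state_space_mass_moment (muP s s0).
pose v s x := - (m i * interaction_force W (mu s) i x).
have close := AC2_transport_close m_gt0 AC.
set lam := m i * _.
have lam0 : 0 < lam by rewrite mulr_gt0.
have continuity f : test_function f ->
    (\int[lebesgue_measure]_(s in `]0%R, +oo[) \int[mu s i]_x
     ('D_(direction true) f (s, x) + v s x * 'D_(direction false) f (s, x))%:E
   = 0)%E.
  move=> ft; rewrite -[RHS](mu_distr i f ft).
  apply: eq_integral => s _; apply: eq_integral => x _; congr (_%:E).
  by rewrite /v; ring.
have contr s x y : 0 <= s -> y <= x -> v s x - v s y <= - lam * (x - y).
  move=> s0 yx.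
  have := interaction_force_mono W_adm i (muP s s0) yx.
  rewrite -(ler_pM2l (m_gt0 i)) mulrA -/lam /v.
  move: (interaction_force _ _ _ x) (interaction_force _ _ _ y) => Fx Fy.
  by rewrite mulNr lerNr (_ : - (_ - _) = m i * (Fx - Fy))//; ring.
have mi0 := m_gt0 i.
have cont s x e : 0 <= s -> 0 < e -> exists2 d : R, 0 < d &
  forall r y, 0 <= r -> `|r - s| <= d -> `|y - x| <= d -> `|v r y - v s x| <= e.
  (* The velocity is [m i] times the force up to sign, whence the rescaled tolerance. The horizon
     [s + 1] and the minimum with 1 allow the use of uniform continuity in time. *)
  move=> s0 e0; have em0 : 0 < e / m i by rewrite divr_gt0.
  have [d1 d10 H1] := interaction_force_continuous W_adm i x (muP s s0) em0.
  have s1 : 0 < s + 1 by rewrite ltr_wpDl.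
  have [d2 d20 H2] := close _ _ s1 d10.
  exists (Num.min 1 (Num.min d1 d2)); first by rewrite !lt_min ltr01 d10.
  move=> r y r0; rewrite !le_min => /and3P[rs1 _ rs2] /and3P[_ yx _].
  have rT : r <= s + 1 by move: rs1; rewrite ler_norml => /andP[_]; rewrite lerBlDl.
  have sT : s <= s + 1 by rewrite lerDl.
  have := H1 (mu r) y (muP r r0) _ _ yx.
  move=> /(_ (fun j => H2 r s j r0 rT s0 sT rs2)).
  rewrite distrC in rs2; move=> /(_ (fun j => H2 s r j s0 sT r0 rT rs2)).
  rewrite /v -opprD -mulrN -mulrDr normrN normrM gtr0_norm// => h.
  by rewrite mulrC -ler_pdivlMr.
have growth s : 0 <= s -> exists C d : R, 0 < d /\
    forall r x, 0 <= r -> `|r - s| <= d -> `|v r x| <= C * (1 + `|x|).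
  move=> s0; have [C HC] := interaction_force_growth W_adm i (muP s s0).
  have s1 : 0 < s + 1 by rewrite ltr_wpDl.
  have [d d0 Hd] := close _ _ s1 ltr01.
  exists (m i * C), (Num.min 1 d); split; first by rewrite lt_min ltr01.
  move=> r x r0; rewrite le_min => /andP[rs1 rsd].
  have rT : r <= s + 1 by move: rs1; rewrite ler_norml => /andP[_]; rewrite lerBlDl.
  have sT : s <= s + 1 by rewrite lerDl.
  rewrite /v normrN normrM gtr0_norm// -mulrA ler_pM2l//.
  by apply: HC (muP r r0) _ => j; exact: Hd.
have closei T e : 0 < T -> 0 < e -> exists2 d : R, 0 < d &
  forall s r : R, 0 <= s -> s <= T -> 0 <= r -> r <= T -> `|s - r| <= d ->
  transport_close e (mu s i) (mu r i).
  by move=> T0 e0; have [d d0 Hd] := close T e T0 e0; exists d => // s r; exact: Hd.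
have supp0 : msupp (mu 0 i) = msupp (mu0 i) by exact: eq_measure_msupp.
(* Positive mass forces a nonempty support, so the initial diameter is a genuine nonnegative
   real. *)
have ne : msupp (mu0 i) !=set0.
  have [mass0 _ _] := mu0P.
  by apply: msupp_nonempty; rewrite mass0 gt_eqF// lte_fin.
have [D D0 [-> HD]] := diam_bounded supp_compact ne.
rewrite -EFinM; apply: diam_le => x y sx sy.
apply: (@msupp_contraction _ (fun s => mu s i) (p i) v lam) => //.
- exact: mu_mass.
- by move=> x' y'; rewrite supp0; exact: HD.
Qed.
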